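(* Let $T>0$, $d\ge1$, $1\le p<\infty$ and $x_0\in R^d$. Let $F:[0,T]\to Conv(R^d)$ be a Hukuhara differentiable set-valued function with $F\in BV_p(Conv(R^d))$ and $F(0)=\{x_0\}$. Then the set $$\mathcal{IS}(F)=\{f\in BV_p(R^d):\ f\in S_{V_p}(F)\ \text{and}\ f'\in S_{L^p}(D_H(F))\}$$ is $V_p$-decomposable and therefore it is an integral.
   Context: $R^d$ carries the Euclidean norm $\|\cdot\|$. $Conv(R^d)$ is the family of nonempty compact convex subsets of $R^d$, with the Hausdorff metric $H_{R^d}$. For a function $f$ from $[0,T]$ into a metric space $(E,\rho)$, the Riesz $p$-variation is $V_p(f)=\sup\sum_{i=1}^n\frac{\rho(f(t_{i-1}),f(t_i))^p}{(t_i-t_{i-1})^{p-1}}$, the supremum being over all partitions $0=t_0<\dots<t_n=T$. $BV_p(R^d)$ and $BV_p(Conv(R^d))$ are the classes of functions $[0,T]\to R^d$, respectively $[0,T]\to(Conv(R^d),H_{R^d})$, with finite $V_p$. $S_{V_p}(F)=\{f\in BV_p(R^d): f(t)\in F(t),\ t\in[0,T]\}$. For a measurable set-valued $\Phi$ on $[0,T]$, $S_{L^p}(\Phi)=\{\phi\in L^p([0,T],R^d):\phi(t)\in\Phi(t)\text{ for a.e. }t\}$; $\Phi$ is $p$-integrably bounded if there is $g\in L^p([0,T])$ with $\sup_{a\in\Phi(t)}\|a\|\le g(t)$ for a.e. $t$. For $A,B\in Conv(R^d)$, the Hukuhara difference $A\div B$ is the set $C\in Conv(R^d)$ with $A=B+C$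 (Minkowski sum), if it exists. $G:[0,T]\to Conv(R^d)$ is Hukuhara differentiable at $t_0$ if there is $D_HG(t_0)=D_H(G)(t_0)\in Conv(R^d)$ such that the limits $\lim_{\Delta t\to0+}\frac{G(t_0+\Delta t)\div G(t_0)}{\Delta t}$ and $\lim_{\Delta t\to0+}\frac{G(t_0)\div G(t_0-\Delta t)}{\Delta t}$ exist and both equal $D_HG(t_0)$; it is Hukuhara differentiable if this holds at every point of $[0,T]$ (only the one-sided limit that makes sense being required at the endpoints). A set $\Lambda\subset BV_p(R^d)$ is $V_p$-decomposable if for every $f_1,f_2\in\Lambda$ and every $a\in[0,T]$ the function $(f_1\oplus_a f_2)(t)=f_1(0)+\int_0^t\big(\mathbf{1}_{[0,a)}(s)f_1'(s)+\mathbf{1}_{[a,T]}(s)f_2'(s)\big)ds$ belongs to $\Lambda$ (here $f_i'$ is the a.e. derivative of $f_i$). A set $\mathcal{R}\subset BV_p(R^d)$ is called an integral if there exist $x_0\in R^d$ and a measurable and $p$-integrably bounded set-valued function $\Phi:[0,T]\to Conv(R^d)$ such that $\mathcal{R}=\{f\in BV_p(R^d): f(\cdot)=x_0+\int_0^{\cdot}\phi(s)\,ds,\ \phi\in S_{L^p}(\Phi)\}$.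
   Formalization: That IS(F) is an integral is claimed only for p>1; V_p-decomposability is kept for all p≥1. For p=1 it fails: with F(t)=[0,t], the function 0 on [0,T/2), T/4 on [T/2,T] lies in IS(F) but is discontinuous, while members of an integral are continuous. *)

(* Defs.v *)
From mathcomp Require Import all_boot all_order all_algebra.
From mathcomp Require Import all_classical all_reals all_analysis.

Set Implicit Arguments.
Unset Strict Implicit.
Unset Printing Implicit Defensive.

Import Order.TTheory GRing.Theory Num.Theory.
Import numFieldNormedType.Exports.

Local Open Scope classical_set_scope.
Local Open Scope ring_scope.

(* R^d is 'rV[R]_d.  Its library norm is the max-norm, which induces the same
   topology (hence the same open and compact sets and the same derivatives) as
   the Euclidean norm; wherever a metric matters, [enorm] is used.

   Functions on [0, T] are represented by total functions on R whose values
   off [0, T] are irrelevant.  Accordingly, a set of functions on [0, T] is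
   represented by a set of total functions closed under modification off
   [0, T]; all the sets of functions defined below have this property. *)

Section Geometry.
Variables (R : realType) (d : nat).
Implicit Types (A B C D : set 'rV[R]_d).

Definition enorm (x : 'rV[R]_d) : R := Num.sqrt (\sum_i (x 0 i) ^+ 2).

Definition edistance (x y : 'rV[R]_d) : R := enorm (x - y).

Definition conv_body A : Prop :=
  [/\ A !=set0, compact A & convex_set (A : set (convex_lmodType 'rV[R]_d))].

Definition excess A B : R :=
  sup [set inf [set edistance a b | b in B] | a in A].

Definition hausdorff A B : R := Num.max (excess A B) (excess B A).

Definition minkowski A B : set 'rV[R]_d := [set a + b | a in A & b in B].

(* [hukuhara_diff A B C]: the Hukuhara difference of A and B exists and
   equals C; C is unique when A and B are convex bodies. *)
Definition hukuhara_diff A B C : Prop := conv_body C /\ A = minkowski B C.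

(* (A h -:- B h) / h exists for all small h > 0 and tends to D as h -> 0+ *)
Definition hukuhara_quot_cvg (A B : R -> set 'rV[R]_d) D : Prop :=
  forall e : R, 0 < e -> \forall h \near 0^'+,
    exists2 C, hukuhara_diff (A h) (B h) C
             & hausdorff [set h^-1 *: c | c in C] D < e.

End Geometry.

Section RieszVariation.
Variables (R : realType) (T p : R).

Definition riesz_sum (E : Type) (rho : E -> E -> R) (f : R -> E) (s : seq R) :=
  \sum_(i < size s)
    rho (f (nth 0 (0 :: s) i)) (f (nth 0 s i)) `^ p /
    (nth 0 s i - nth 0 (0 :: s) i) `^ (p - 1).

Definition riesz_variation (E : Type) (rho : E -> E -> R) (f : R -> E) :
    \bar R :=
  ereal_sup [set (riesz_sum rho f s)%:E | s in itv_partition 0 T].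

End RieszVariation.

Section SetValued.
Variables (R : realType) (d : nat) (T p : R).

Notation V := 'rV[R]_d.
Notation mu := (@lebesgue_measure R).
Notation I := [set` `[0, T]].

Definition BV : set (R -> V) :=
  [set f | (riesz_variation T p (@edistance R d) f < +oo)%E].

Definition conv_valued (F : R -> set V) : Prop :=
  forall t, t \in `[0, T] -> conv_body (F t).

Definition BV_conv : set (R -> set V) :=
  [set F | conv_valued F /\
           (riesz_variation T p (@hausdorff R d) F < +oo)%E].

Definition S_V (F : R -> set V) : set (R -> V) :=
  [set f | BV f /\ forall t, t \in `[0, T] -> F t (f t)].

(* Measurability in the library is Borel measurability.  Elements of L^p are
   required to be Lebesgue measurable, i.e. a.e. equal to a Borel function. *)
Definition Lp_fun : set (R -> V) :=
  [set phi | exists psi : R -> V,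
    [/\ phi = psi %[ae mu in I],
        forall i, measurable_fun I (fun t => psi t 0 i) &
        (\int[mu]_(t in I) (enorm (psi t) `^ p)%:E < +oo)%E]].

Definition S_L (Phi : R -> set V) : set (R -> V) :=
  [set phi | Lp_fun phi /\ {ae mu, forall t, I t -> Phi t (phi t)}].

Definition set_measurable (Phi : R -> set V) : Prop :=
  forall U : set V, open U ->
    measurable (I `&` [set t | Phi t `&` U !=set0]).

Definition p_integrably_bounded (Phi : R -> set V) : Prop :=
  exists g : R -> R,
    [/\ measurable_fun I g,
        (\int[mu]_(t in I) (`|g t| `^ p)%:E < +oo)%E &
        {ae mu, forall t, I t -> sup [set enorm a | a in Phi t] <= g t}].

Definition is_hukuhara_derive (G : R -> set V) (t : R) (D : set V) : Prop :=
  [/\ conv_body D,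
      t < T -> hukuhara_quot_cvg (fun h => G (t + h)) (fun=> G t) D &
      0 < t -> hukuhara_quot_cvg (fun=> G t) (fun h => G (t - h)) D].

Definition hukuhara_differentiable (G : R -> set V) : Prop :=
  forall t, t \in `[0, T] -> exists D, is_hukuhara_derive G t D.

(* The Hukuhara derivative, which is unique when it exists. *)
Definition D_H (G : R -> set V) (t : R) : set V :=
  xget set0 [set D | is_hukuhara_derive G t D].

Definition vintegral (phi : R -> V) (t : R) : V :=
  \row_i (\int[mu]_(s in `[0, t]) phi s 0 i).

Definition oplus (a : R) (f1 f2 : R -> V) (t : R) : V :=
  f1 0 + vintegral (fun s => (\1_(`[0, a[) s : R) *: derive1 f1 s +
                             (\1_(`[a, T]) s : R) *: derive1 f2 s) t.

Definition decomposable (L : set (R -> V)) : Prop :=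
  L `<=` BV /\
  forall f1 f2 a, L f1 -> L f2 -> a \in `[0, T] -> L (oplus a f1 f2).

(* For p = 1, BV contains discontinuous functions, whereas all the members of
   an integral are absolutely continuous on [0, T]. *)
Definition is_integral (L : set (R -> V)) : Prop :=
  L `<=` BV /\
  exists (x0 : V) (Phi : R -> set V),
    [/\ conv_valued Phi, set_measurable Phi, p_integrably_bounded Phi &
        L = [set f | BV f /\ exists2 phi, S_L Phi phi &
               forall t, t \in `[0, T] -> f t = x0 + vintegral phi t]].

(* [derive1 f] has a default value where f is not derivable, whence the
   explicit requirement that the derivative exist a.e. (it is automatic for f
   in BV, by Lebesgue's theorem). *)
Definition IS (F : R -> set V) : set (R -> V) :=
  [set f | [/\ BV f, S_V F f, {ae mu, forall t, I t -> derivable f t 1} &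
               S_L (D_H F) (derive1 f)]].

End SetValued.

(* Main.v *)
Require Import Defs.
From mathcomp Require Import all_boot all_order all_algebra.
From mathcomp Require Import all_classical all_reals all_analysis.
From mathcomp Require Import measurable_realfun.
From mathcomp Require Import lra ring.
Import Order.TTheory GRing.Theory Num.Theory.
Import numFieldNormedType.Exports.
Local Open Scope classical_set_scope.
Local Open Scope ring_scope.

Set Implicit Arguments.
Unset Strict Implicit.
Unset Printing Implicit Defensive.

(* Let q_u(t) be the support function of F(t) in the direction u.  Hukuhara
   differentiability makes q_u differentiable at every point of [0, T], its
   derivative being the support function of D_H F(t).

   If phi is an integrable selection of D_H F, then <u, phi> <= q_u' a.e., so
   <u, x0 + int_0^t phi> <= q_u(t), and x0 + int_0^t phi lies in F(t) by separation.
   For p = 1 nothing makes q_u' integrable; the inequality is obtained from the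
   differentiability of q_u everywhere, by truncating <u, phi> from above and adding
   a small increasing function with infinite derivative on the exceptional null set.
   Hence every such x0 + int phi belongs to IS(F), which gives decomposability.

   If p > 1, a function in BV_p is the integral of its derivative, because the
   slopes over uniform partitions are bounded in L^p.  By Fatou's lemma the same
   slopes, taken for q_u, bound D_H F in L^p. *)

(** The two conclusions need different amounts of regularity. [oplus] sees its arguments only
    through their derivatives and their common initial value x0, so decomposability only requires
    that indefinite integrals of selections of [D_H] stay in IS(F); this holds for every p >= 1. The
    converse, that a member is the integral of its own derivative, fails at p = 1: for F(t) =
    [-t, t], the function equal to 0 before T/2 and to T/2 from there on lies in IS(F) but is
    discontinuous. Hence the restriction p > 1 in the second conclusion.

    Support functions suit the problem because they turn Minkowski sums into sums, so a Hukuhara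
    difference, given only implicitly, becomes a difference of real numbers, and because they are
    Lipschitz for the Hausdorff distance, so a finite variation of F passes to each q_u. They also
    give the measurability of [D_H]: each one is a pointwise limit of step functions, and countably
    many of them decide whether a convex body meets a given ball. *)

(** * Support functions of convex bodies *)

Section Support.
Variables (R : realType) (d : nat).
Implicit Types (u v x y : 'rV[R]_d) (A B C : set 'rV[R]_d).

Definition dot u v : R := \sum_i u 0 i * v 0 i.

Lemma dotDr u v w : dot u (v + w) = dot u v + dot u w.
Proof. by rewrite /dot -big_split; apply: eq_bigr => i _; rewrite mxE mulrDr. Qed.

Lemma dotZr c u v : dot u (c *: v) = c * dot u v.
Proof. by rewrite /dot mulr_sumr; apply: eq_bigr => i _; rewrite mxE mulrCA. Qed.

Lemma dotBr u v w : dot u (v - w) = dot u v - dot u w.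
Proof. by rewrite dotDr -scaleN1r dotZr mulN1r. Qed.

Lemma dotC u v : dot u v = dot v u.
Proof. by apply: eq_bigr => i _; rewrite mulrC. Qed.

Lemma dot_ge0 u : 0 <= dot u u.
Proof. by apply: sumr_ge0 => i _; rewrite -expr2 sqr_ge0. Qed.

Lemma dot_eq0 u : dot u u <= 0 -> u = 0.
Proof.
move=> u0; have /eqP : dot u u = 0 by apply/eqP; rewrite eq_le u0 dot_ge0.
rewrite psumr_eq0 => [|i _]; last by rewrite -expr2 sqr_ge0.
move=> /allP u_eq0; apply/rowP => i; rewrite mxE; apply/eqP.
by have := u_eq0 i (mem_index_enum i); rewrite /= mulf_eq0 orbb.
Qed.

Lemma dot_delta i v : dot (delta_mx 0 i) v = v 0 i.
Proof.
rewrite /dot (bigD1 i)//= big1 ?addr0 => [|j /negPf ji]; rewrite mxE !eqxx ?mul1r//.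
by rewrite ji mul0r.
Qed.

Lemma dotNl u v : dot (- u) v = - dot u v.
Proof. by rewrite /dot -sumrN; apply: eq_bigr => i _; rewrite mxE mulNr. Qed.

(** The l1 norm is the constant in the estimates against [enorm]: bounding each coordinate of v by
    [enorm v] gives them term by term. *)
Definition norm1 u : R := \sum_i `|u 0 i|.

Lemma norm1_ge0 u : 0 <= norm1 u.
Proof. exact: sumr_ge0. Qed.

Lemma enorm_ge0 v : 0 <= enorm v.
Proof. exact: sqrtr_ge0. Qed.

Lemma coord_le_enorm v i : `|v 0 i| <= enorm v.
Proof.
rewrite -sqrtr_sqr ler_wsqrtr// (bigD1 i)//= lerDl.
by apply: sumr_ge0 => j _; exact: sqr_ge0.
Qed.

Lemma enorm_le_norm1 v : enorm v <= norm1 v.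
Proof.
rewrite -[leRHS]ger0_norm ?norm1_ge0// -[leRHS]sqrtr_sqr ler_wsqrtr//.
rewrite expr2 {1}/norm1 mulr_suml; apply: ler_sum => i _.
rewrite -normr_id -real_normK ?num_real// expr2 normr_id ler_wpM2l//.
by rewrite /norm1 (bigD1 i)//= lerDl sumr_ge0.
Qed.

Lemma dot_le_enorm u v : `|dot u v| <= norm1 u * enorm v.
Proof.
rewrite (le_trans (ler_norm_sum _ _ _))// mulr_suml; apply: ler_sum => i _.
by rewrite normrM ler_wpM2l// coord_le_enorm.
Qed.

(** Exactly what makes the supremum in [support] meaningful; it passes to dilates without any
    argument about compactness or convexity. *)
Definition bounded_body A := A !=set0 /\ exists M, forall a, A a -> enorm a <= M.

Lemma conv_body_bounded A : conv_body A -> bounded_body A.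
Proof.
move=> [A0 /compact_bounded [M [_ AM]] _]; split=> //.
(* Compactness bounds the max-norm by every number above M, in particular by M + 1; summing over the
   d coordinates bounds [norm1], hence [enorm]. *)
exists (\sum_(i < d) (M + 1)) => a Aa.
rewrite (le_trans (enorm_le_norm1 a))//; apply: ler_sum => i _.
apply: le_trans (AM (M + 1) _ a Aa); last by rewrite ltrDl.
rewrite [leRHS]/Num.Def.normr/= mx_normrE.
exact: (le_bigmax _ (fun ij => `|a ij.1 ij.2|) (0, i)).
Qed.

Definition support A u : R := sup [set dot u a | a in A].

Lemma bounded_body_has_sup A u :
  bounded_body A -> has_sup [set dot u a | a in A].
Proof.
move=> [[a Aa] [M AM]]; split; first by exists (dot u a), a.
exists (norm1 u * M) => _ [b Ab <-].
rewrite (le_trans (ler_norm _))// (le_trans (dot_le_enorm _ _))//.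
by rewrite ler_wpM2l ?norm1_ge0 ?AM.
Qed.

Lemma dot_le_support A u a : bounded_body A -> A a -> dot u a <= support A u.
Proof.
by move=> Ab Aa; apply: sup_upper_bound; [exact: bounded_body_has_sup|exists a].
Qed.

Lemma support_le A u c :
  A !=set0 -> (forall a, A a -> dot u a <= c) -> support A u <= c.
Proof.
move=> [a Aa] Ac; apply: ge_sup; first by exists (dot u a), a.
by move=> _ [b Ab <-]; exact: Ac.
Qed.

Lemma support_set1 x u : support [set x] u = dot u x.
Proof. by rewrite /support image_set1 sup1. Qed.

Lemma support_minkowski B C u : bounded_body B -> bounded_body C ->
  support (Defs.minkowski B C) u = support B u + support C u.
Proof.
move=> bB bC; have [[b0 Bb0] _] := bB; have [[c0 Cc0] _] := bC.
apply/eqP; rewrite eq_le; apply/andP; split.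
  apply: support_le => [|_ [b Bb [c Cc <-]]].
    by exists (b0 + c0), b0 => //; exists c0.
  by rewrite dotDr lerD ?dot_le_support.
have sBC b c : B b -> C c -> dot u b + dot u c <= support (Defs.minkowski B C) u.
  move=> Bb Cc; rewrite -dotDr; apply: dot_le_support.
    split; first by exists (b0 + c0), b0 => //; exists c0.
    have [_ [M BM]] := bB; have [_ [N CN]] := bC.
    exists (\sum_(i < d) (M + N)) => _ [b' Bb' [c' Cc' <-]].
    rewrite (le_trans (enorm_le_norm1 _))//; apply: ler_sum => i _.
    rewrite mxE (le_trans (ler_normD _ _))// lerD//.
      exact: le_trans (coord_le_enorm _ _) (BM _ Bb').
    exact: le_trans (coord_le_enorm _ _) (CN _ Cc').
  by exists b => //; exists c.
rewrite -lerBrDr; apply: support_le => [|b Bb]; first by exists b0.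
rewrite lerBrDr -lerBrDl; apply: support_le => [|c Cc]; first by exists c0.
by rewrite lerBrDl sBC.
Qed.

Lemma bounded_body_scale A h :
  bounded_body A -> bounded_body [set h *: a | a in A].
Proof.
move=> [[a Aa] [M AM]]; split; first by exists (h *: a), a.
exists (\sum_(i < d) (`|h| * M)) => _ [b Ab <-].
rewrite (le_trans (enorm_le_norm1 _))//; apply: ler_sum => i _.
rewrite mxE normrM ler_wpM2l//.
exact: le_trans (coord_le_enorm _ _) (AM _ Ab).
Qed.

Lemma support_scale A h u : 0 < h -> bounded_body A ->
  support [set h *: a | a in A] u = h * support A u.
Proof.
move=> h0 bA; have [[a0 Aa0] _] := bA; apply/eqP; rewrite eq_le; apply/andP; split.
  apply: support_le => [|_ [a Aa <-]]; first by exists (h *: a0), a0.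
  by rewrite dotZr ler_pM2l// dot_le_support.
rewrite -ler_pdivlMl//; apply: support_le => [|a Aa]; first by exists a0.
rewrite ler_pdivlMl// -dotZr; apply: dot_le_support; last by exists a.
exact: bounded_body_scale.
Qed.

Lemma has_lbound_edistance a B : has_lbound [set edistance a b | b in B].
Proof. by exists 0 => _ [b _ <-]; exact: enorm_ge0. Qed.

Lemma inf_edistance_le_hausdorff A B a : bounded_body A -> bounded_body B ->
  A a -> inf [set edistance a b | b in B] <= hausdorff A B.
Proof.
move=> [_ [M AM]] [[b0 Bb0] _] Aa.
rewrite le_max; apply/orP; left; apply: ub_le_sup; last by exists a.
exists (\sum_(i < d) (M + `|b0 0 i|)) => _ [c Ac <-].
apply: (@le_trans _ _ (edistance c b0)).
  by apply: ge_inf; [exact: has_lbound_edistance|exists b0].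
rewrite (le_trans (enorm_le_norm1 _))//; apply: ler_sum => i _.
rewrite !mxE (le_trans (ler_normB _ _))// lerD2r.
exact: le_trans (coord_le_enorm _ _) (AM _ Ac).
Qed.

Lemma hausdorffC A B : hausdorff A B = hausdorff B A.
Proof. by rewrite /hausdorff maxC. Qed.

Lemma hausdorff_ge0 A B : bounded_body A -> bounded_body B -> 0 <= hausdorff A B.
Proof.
move=> bA bB; have [[a Aa] _] := bA; have [[b Bb] _] := bB.
apply: le_trans (inf_edistance_le_hausdorff bA bB Aa).
apply: lb_le_inf; first by exists (edistance a b), b.
by move=> _ [c _ <-]; exact: enorm_ge0.
Qed.

Lemma support_le_hausdorff A B u : bounded_body A -> bounded_body B ->
  support A u <= support B u + norm1 u * hausdorff A B.
Proof.
move=> bA bB; have [A0 _] := bA; have [[b0 Bb0] _] := bB.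
apply: support_le => // a Aa.
rewrite -lerBlDl; have := inf_edistance_le_hausdorff bA bB Aa.
(* Dividing by [norm1 u] lets the estimate be checked against each b under the infimum; when
   [norm1 u] is 0, [dot u] vanishes identically. *)
have := norm1_ge0 u; rewrite le_eqVlt => /predU1P[u0 _|u0 dAB].
  rewrite -u0 mul0r subr_le0 (le_trans _ (dot_le_support _ bB Bb0))//.
  rewrite -subr_le0 -dotBr (le_trans (ler_norm _))//.
  by rewrite (le_trans (dot_le_enorm _ _))// -u0 mul0r.
rewrite -ler_pdivrMl// (le_trans _ dAB)//.
apply: lb_le_inf; first by exists (edistance a b0), b0.
move=> _ [b Bb <-]; rewrite ler_pdivrMl//.
rewrite (le_trans _ (dot_le_enorm _ _))// (le_trans _ (ler_norm _))// dotBr lerB//.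
exact: dot_le_support.
Qed.

Lemma support_dist_hausdorff A B u : bounded_body A -> bounded_body B ->
  `|support A u - support B u| <= norm1 u * hausdorff A B.
Proof.
move=> bA bB; have := support_le_hausdorff u bA bB.
have := support_le_hausdorff u bB bA; rewrite hausdorffC ler_norml; lra.
Qed.

Lemma dot_subZ (l : R) u v :
  dot (u - l *: v) (u - l *: v) = dot u u - 2 * l * dot u v + l ^+ 2 * dot v v.
Proof.
rewrite dotBr dotZr !(dotC (u - _)) !dotBr !dotZr (dotC v u); ring.
Qed.

Lemma dot_continuous : continuous (fun u : 'rV[R]_d => dot u u).
Proof.
apply: continuous_big => [|i _ v]; first exact: add_continuous.
by apply: continuousM; exact: coord_continuous.
Qed.

(** The nearest point of A to y, with the variational inequality that characterises it. *)
Lemma conv_body_projection A y : conv_body A ->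
  exists2 a, A a & forall b, A b -> dot (y - a) (b - a) <= 0.
Proof.
move=> [A0 cA coA].
have [|a /set_mem Aa amin] := EVT_min_rV A0 cA (f := fun a => dot (y - a) (y - a)).
  apply: continuous_subspaceT => a.
  apply: (@continuous_comp _ _ _ (fun a : 'rV[R]_d => y - a)
    (fun z : 'rV[R]_d => dot z z) a).
    by apply: continuousB; [exact: cst_continuous|].
  exact: dot_continuous.
exists a => // b Ab; rewrite leNgt; apply/negP => ab0.
set c := dot (y - a) (b - a) in ab0; set q := dot (b - a) (b - a).
have q0 : 0 <= q := dot_ge0 _.
(* Moving from a towards b by the fraction l changes the squared distance to y by this amount. *)
have key (l : {i01 R}) : 0 <= l%:num * (l%:num * q - 2 * c).
  have Al : (l%:num *: b + (1 - l%:num) *: a) \in A.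
    exact: (coA b a l (mem_set Ab) (mem_set Aa)).
  have := amin _ Al; rewrite -subr_ge0.
  have -> : y - (l%:num *: b + (1 - l%:num) *: a) = (y - a) - l%:num *: (b - a).
    by apply/rowP => i; rewrite !mxE; ring.
  rewrite dot_subZ -/c -/q.
  by move=> /le_trans; apply; rewrite le_eqVlt; apply/orP; left; apply/eqP; ring.
(* This fraction l satisfies l q <= c, so l q - 2 c <= - c < 0, against [key]. *)
have l0 : 0 <= c / (q + c + 1) by rewrite divr_ge0 ?ltW//; lra.
have l1 : c / (q + c + 1) <= 1 by rewrite ler_pdivrMr; lra.
have := key (Itv01 l0 l1) => /=; rewrite pmulr_rge0; last first.
  by rewrite divr_gt0//; lra.
have : c / (q + c + 1) * q <= c.
  by rewrite mulrAC ler_pdivrMr; [nra|lra].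
lra.
Qed.

(** If a is the projection of y, the direction u = y - a gives dot u y <= support A u <= dot u a,
    that is, dot u u <= 0. *)
Lemma conv_body_mem A y : conv_body A ->
  (forall u, dot u y <= support A u) -> A y.
Proof.
move=> cA yA; have [a Aa ap] := conv_body_projection y cA.
suff -> : y = a by [].
apply/eqP; rewrite -subr_eq0; apply/eqP/dot_eq0.
rewrite dotBr subr_le0 (le_trans (yA _))//.
apply: support_le => [|b Ab]; first by exists a.
by rewrite -subr_le0 -dotBr ap.
Qed.

(* [2 dot u (x - b) - dot u u] is at most [dot (x - b) (x - b)], with equality at
   [u = x - b]. *)
Lemma conv_body_meets_ball A x r : conv_body A ->
  (exists2 b, A b & dot (x - b) (x - b) <= r) <->
  forall u, 2 * dot u x - 2 * support A u - dot u u <= r.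
Proof.
move=> cA; have bA := conv_body_bounded cA; split=> [[b Ab xbr] u|xr].
  have := dot_le_support u bA Ab; have := dot_ge0 (x - b - 1 *: u).
  rewrite dot_subZ (dotC (x - b) u) (dotBr u); nra.
have [a Aa ap] := conv_body_projection x cA; exists a => //.
have : support A (x - a) <= dot (x - a) a.
  apply: support_le => [|b Ab]; first by exists a.
  by rewrite -subr_le0 -dotBr ap.
have xE : dot (x - a) x = dot (x - a) (x - a) + dot (x - a) a.
  by rewrite -dotDr subrK.
by have := xr (x - a); lra.
Qed.
End Support.

(** * Differentiability relative to an interval *)

(* The derivative is relative to [0, T], hence one-sided at the endpoints. *)
Definition derives_within (R : realType) (T : R) (q : R -> R) (t l : R) : Prop :=
  forall e, 0 < e -> exists2 r, 0 < r &
    forall s, s \in `[0, T] -> `|s - t| < r ->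
      `|q s - q t - (s - t) * l| <= e * `|s - t|.

Lemma near_at_right0 (R : realType) (P : R -> Prop) :
  (\forall h \near 0^'+, P h) ->
  exists2 r : R, 0 < r & forall h, 0 < h -> h < r -> P h.
Proof.
move=> [r /= r0 rP]; exists r => // h h0 hr; apply: rP => //=.
by rewrite sub0r normrN gtr0_norm.
Qed.

Section HukuharaSupport.
Variables (R : realType) (d : nat) (T : R).
Implicit Types (F : R -> set 'rV[R]_d) (u : 'rV[R]_d).

Lemma D_H_spec F t : hukuhara_differentiable T F -> t \in `[0, T] ->
  is_hukuhara_derive T F t (D_H T F t).
Proof. by move=> hF tT; apply: (@xgetPex _ set0); exact: hF. Qed.

Lemma D_H_conv_body F t : hukuhara_differentiable T F -> t \in `[0, T] ->
  conv_body (D_H T F t).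
Proof. by move=> hF /(D_H_spec hF)[]. Qed.

(** From A h = B h + C, the difference of the support functions is h times the support function of C
    / h, which is close to that of D. Both A and B depend on h, so as to cover the quotients on
    either side. *)
Lemma hukuhara_quot_support (A B : R -> set 'rV[R]_d) D u e :
  (\forall h \near 0^'+, bounded_body (A h)) ->
  (\forall h \near 0^'+, bounded_body (B h)) ->
  conv_body D -> hukuhara_quot_cvg A B D -> 0 < e ->
  \forall h \near 0^'+,
    `|support (A h) u - support (B h) u - h * support D u| <= e * h.
Proof.
move=> bA bB /conv_body_bounded bD AB e0.
(* The summand 1 allows division even when u = 0. *)
have u1 : 0 < norm1 u + 1 by rewrite ltr_wpDl ?norm1_ge0.
near=> h.
have h0 : 0 < h by [].
have [C [cC AhE]] : exists2 C, hukuhara_diff (A h) (B h) C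
    & hausdorff [set h^-1 *: c | c in C] D < e / (norm1 u + 1).
  by near: h; apply: AB; rewrite divr_gt0.
rewrite ltr_pdivlMr// => hCD.
have bC := conv_body_bounded cC.
have -> : support (A h) u = support (B h) u + support C u.
  by rewrite AhE support_minkowski//; near: h.
have -> : support C u = h * support [set h^-1 *: c | c in C] u.
  by rewrite support_scale ?invr_gt0// mulVKf// gt_eqF.
rewrite [support (B h) u + _]addrC addrK -mulrBr normrM (gtr0_norm h0) mulrC ler_pM2r//.
have bhC := bounded_body_scale h^-1 bC.
rewrite (le_trans (support_dist_hausdorff u bhC bD))//.
have := hausdorff_ge0 bhC bD; lra.
Unshelve. all: by end_near. Qed.

Lemma support_derives_within F u t :
  hukuhara_differentiable T F -> conv_valued T F -> t \in `[0, T] ->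
  derives_within T (fun s => support (F s) u) t (support (D_H T F t) u).
Proof.
move=> hF cF tT e e0; have [cD DR DL] := D_H_spec hF tT.
have bF s : s \in `[0, T] -> bounded_body (F s).
  by move=> sT; exact/conv_body_bounded/cF.
have := tT; rewrite in_itv/= => /andP[t0 tT'].
(* At t = T the condition t + h <= T excludes every h > 0, so any radius serves; t = 0 is treated in
   the same way on the left. *)
have [r r0 rP] : exists2 r, 0 < r & forall h, 0 < h -> h < r -> t + h <= T ->
    `|support (F (t + h)) u - support (F t) u - h * support (D_H T F t) u| <= e * h.
  move: tT'; rewrite le_eqVlt => /predU1P[->|tT'].
    by exists 1 => // h h0 _; lra.
  have [||r r0 rP] := near_at_right0 (hukuhara_quot_support u _ _ cD (DR tT') e0).
  - near=> h; apply: bF; rewrite in_itv/=; apply/andP; split.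
      by rewrite addr_ge0// ltW.
    by rewrite -lerBrDl; near: h; apply: nbhs_right_le; rewrite subr_gt0.
  - by near=> h; exact: bF.
  - by exists r => // h h0 hr _; exact: rP.
have [r' r'0 r'P] : exists2 r, 0 < r & forall h, 0 < h -> h < r -> 0 <= t - h ->
    `|support (F t) u - support (F (t - h)) u - h * support (D_H T F t) u| <= e * h.
  move: t0; rewrite le_eqVlt => /predU1P[<-|t0].
    by exists 1 => // h h0 _; lra.
  have [||s s0 sP] := near_at_right0 (hukuhara_quot_support u _ _ cD (DL t0) e0).
  - by near=> h; exact: bF.
  - near=> h; apply: bF; rewrite in_itv/=; apply/andP; split.
      by rewrite subr_ge0; near: h; exact: nbhs_right_le.
    by rewrite (le_trans _ tT')// gerBl ltW.
  - by exists s => // h h0 hs _; exact: sP.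
exists (Num.min r r'); first by rewrite lt_min r0.
move=> s; rewrite in_itv/= lt_min => /andP[s0 sT] /andP[sr sr'].
case: (ltgtP s t) => [st|ts|->]; last by rewrite !subrr mul0r subr0 normr0 mulr0.
- have h0 : 0 < t - s by rewrite subr_gt0.
  have stE : `|s - t| = t - s by rewrite distrC gtr0_norm.
  rewrite stE in sr' *; have := r'P _ h0 sr'; rewrite subKr => /(_ s0).
  by rewrite -[in X in _ -> X]normrN; congr (_ <= _); congr `|_|; ring.
- have h0 : 0 < s - t by rewrite subr_gt0.
  have := rP _ h0; rewrite (gtr0_norm h0) in sr *.
  by rewrite subrKC; apply.
Unshelve. all: by end_near. Qed.
End HukuharaSupport.

(** * Step functions of slopes and the Riesz variation *)

Section StepFunctions.
Variables (R : realType) (T : R).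
Hypothesis T_gt0 : 0 < T.
Notation mu := (@lebesgue_measure R).

Definition mesh n : R := T / n.+1%:R.

Definition grid n i : R := mesh n * i%:R.

Definition slope (q : R -> R) n i : R := (q (grid n i.+1) - q (grid n i)) / mesh n.

(** The derivative of the polygonal interpolation of q. The pieces are half-open, so the value at T
    is 0 and convergence is claimed only for t < T. *)
Definition step (q : R -> R) n (t : R) : R :=
  \sum_(i < n.+1) slope q n i * \1_(`[grid n i, grid n i.+1[) t.

Lemma mesh_gt0 n : 0 < mesh n.
Proof. by rewrite divr_gt0. Qed.

Lemma grid0 n : grid n 0 = 0.
Proof. by rewrite /grid mulr0. Qed.

Lemma grid_last n : grid n n.+1 = T.
Proof. by rewrite /grid /mesh divfK. Qed.

Lemma gridS n i : grid n i.+1 = grid n i + mesh n.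
Proof. by rewrite /grid -natr1 mulrDr mulr1. Qed.

Lemma ltr_grid n i j : (grid n i < grid n j) = (i < j)%N.
Proof. by rewrite /grid ltr_pM2l ?mesh_gt0// ltr_nat. Qed.

Lemma ler_grid n i j : (grid n i <= grid n j) = (i <= j)%N.
Proof. by rewrite /grid ler_pM2l ?mesh_gt0// ler_nat. Qed.

Lemma grid_ge0 n i : 0 <= grid n i.
Proof. by rewrite -(grid0 n) ler_grid. Qed.

Lemma grid_piece n t : 0 <= t < T ->
  exists2 i, (i < n.+1)%N & grid n i <= t < grid n i.+1.
Proof.
move=> /andP[t0 tT]; pose i := Num.truncn (t / mesh n).
have /truncn_itv/andP[it ti] : 0 <= t / mesh n by rewrite divr_ge0// ltW// mesh_gt0.
have {}it : grid n i <= t by rewrite /grid mulrC -ler_pdivlMr ?mesh_gt0.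
have {}ti : t < grid n i.+1 by rewrite /grid mulrC -ltr_pdivrMr ?mesh_gt0.
by exists i; [rewrite -(ltr_grid n) grid_last (le_lt_trans it)|rewrite it].
Qed.

Lemma step_piece q n i t : (i < n.+1)%N -> grid n i <= t < grid n i.+1 ->
  step q n t = slope q n i.
Proof.
move=> iN /andP[it ti]; rewrite /step (bigD1 (Ordinal iN))//= big1 => [|j ji].
  by rewrite indicE mem_set ?mulr1 ?addr0//= in_itv/= it.
rewrite indicE memNset ?mulr0//= in_itv/= => /andP[jt tj].
move/eqP: ji; apply; apply/val_inj => /=; apply/eqP; rewrite eqn_leq.
by apply/andP; split; rewrite -ltnS -(ltr_grid n) ?(le_lt_trans jt ti) ?(le_lt_trans it tj).
Qed.

Lemma measurable_step q n D : measurable_fun D (step q n).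
Proof.
apply: measurable_sum => i; apply: measurable_funM; first exact: measurable_cst.
exact: measurable_indic.
Qed.

(** The argument of [k] is real: to use a function of the index, compose it with [Num.truncn], which
    [natrK] cancels on i%:R. *)
Lemma integral_grid (f k : R -> R) n :
  measurable_fun setT f ->
  (forall i t, (i < n.+1)%N -> grid n i <= t < grid n i.+1 -> f t = k i%:R) ->
  (\int[mu]_(t in `[0%R, T]) (f t)%:E)%E = (\sum_(i < n.+1) k i%:R * mesh n)%:E.
Proof.
move=> mf fk.
(* The pieces do not cover T, so this endpoint is discarded before the induction on the number of
   pieces. *)
rewrite -integral_itv_bndo_bndc; last first.
  by apply/measurable_EFinP; exact: measurable_funTS.
suff H m : (m <= n.+1)%N -> (\int[mu]_(t in `[0%R, grid n m[) (f t)%:E)%E =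
    (\sum_(0 <= i < m) k i%:R * mesh n)%:E.
  by have := H _ (leqnn n.+1); rewrite grid_last big_mkord.
elim: m => [|m IHm mn]; first by rewrite grid0 set_itvco0 integral_set0 big_geq.
have -> : `[0, grid n m.+1[%classic =
    `[0, grid n m[%classic `|` `[grid n m, grid n m.+1[%classic.
  by rewrite -itv_bndbnd_setU// ?bnd_simp ?grid_ge0// ler_grid.
rewrite integral_setU//=.
- rewrite IHm; last exact: ltnW.
  rewrite big_nat_recr//= EFinD; congr (_ + _)%E.
  rewrite (eq_integral (cst (k m%:R)%:E)) => [|t]; last first.
    by rewrite inE/= in_itv/= => /(fk _ _ mn) ->.
  rewrite integral_cst//= lebesgue_measure_itv/= lte_fin ltr_grid ltnSn.
  by rewrite -EFinB gridS addrAC subrr add0r EFinM.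
- by apply/measurable_EFinP; exact: measurable_funTS.
- apply/disj_setPS => t [/=]; rewrite !in_itv/= => /andP[_ tm] /andP[mt _].
  by move: tm; rewrite ltNge mt.
Qed.

Lemma integral_step q n :
  (\int[mu]_(t in `[0%R, T]) (step q n t)%:E = (q T - q 0)%:E)%E.
Proof.
rewrite (@integral_grid _ (fun x => slope q n (Num.truncn x)) n).
- congr EFin.
  under eq_bigr do rewrite natrK divfK ?gt_eqF ?mesh_gt0//.
  rewrite -(big_mkord xpredT (fun i => q (grid n i.+1) - q (grid n i))).
  by rewrite telescope_sumr// grid_last grid0.
- exact: measurable_step.
- by move=> i t iN it; rewrite natrK (step_piece q iN it).
Qed.

Lemma itv_partition_grid n : itv_partition 0 T (mkseq (fun i => grid n i.+1) n.+1).
Proof.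
split.
  have -> : mkseq (fun i => grid n i.+1) n.+1 = map (grid n) (iota 1 n.+1).
    by rewrite (iotaDl 1 0) -map_comp.
  rewrite -{1}(grid0 n); change (sorted <%O (map (grid n) (iota 0 n.+2))).
  apply: (@homo_sorted _ _ _ ltn) => [i j|]; first by rewrite ltr_grid.
  exact: iota_ltn_sorted.
by rewrite -nth_last size_mkseq nth_mkseq//= grid_last.
Qed.

(** The integral is the Riesz sum of q over the uniform partition: an increment D over a piece of
    length m contributes m (|D| / m)^p = |D|^p / m^(p-1). *)
Lemma integral_step_powR p q n : 0 < p ->
  (\int[mu]_(t in `[0%R, T]) (`|step q n t| `^ p)%:E <=
   riesz_variation T p (fun x y : R => `|x - y|%R) q)%E.
Proof.
move=> p0; rewrite (@integral_grid _ (fun x => `|slope q n (Num.truncn x)| `^ p) n).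
- apply: ereal_sup_ubound; exists (mkseq (fun i => grid n i.+1) n.+1).
    exact: itv_partition_grid.
  congr EFin; rewrite /riesz_sum size_mkseq; apply: eq_bigr => -[i iN] _ /=.
  have mn := mesh_gt0 n; have m0 := ltW mn.
  rewrite natrK nth_mkseq// (_ : nth 0 _ i = grid n i); last first.
    by case: i iN => [|i] iN; rewrite /= ?grid0// nth_mkseq// ltnW.
  have -> : grid n i.+1 - grid n i = mesh n by rewrite gridS addrAC subrr add0r.
  rewrite /slope distrC normrM normfV (gtr0_norm mn) [RHS]mulrC.
  rewrite (powRM (y := (mesh n)^-1)) ?invr_ge0// mulrCA.
  congr (_ * _); rewrite -(powR_inv1 m0) powRAC powR_inv1 ?powR_ge0//.
  rewrite -(mulr_powRB1 m0 p0) invfM mulVKf ?gt_eqF//.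
- apply: (measurableT_comp (measurable_powR p)).
  by apply: measurableT_comp => //; exact: measurable_step.
- by move=> i t iN it; rewrite natrK (step_piece q iN it).
Qed.
End StepFunctions.

(** * Elementary inequalities for real powers *)

Section Powers.
Variable R : realType.
Implicit Types (a b p y M : R).

Lemma cvg_powR (u : R^nat) l p : 0 < p -> (forall n, 0 <= u n) ->
  u n @[n --> \oo] --> l -> u n `^ p @[n --> \oo] --> l `^ p.
Proof.
move=> p0 u0 ul; have : 0 <= l.
  rewrite -(cvg_lim (@Rhausdorff R) ul); apply: limr_ge; first exact: cvgP ul.
  exact: nearW.
(* For p < 1 the power is not differentiable at 0, so a zero limit is treated directly with the
   threshold e^(1/p). *)
rewrite le_eqVlt => /predU1P[l0|l0].
  rewrite -l0 powR0 ?gt_eqF//; apply/cvgr0Pnorm_le => e e0.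
  have e1 : 0 < e `^ p^-1 by exact: powR_gt0.
  rewrite -l0 in ul; have /cvgr0Pnorm_le/(_ _ e1) := ul.
  apply: filterS => n un; rewrite ger0_norm ?powR_ge0//.
  have -> : e = (e `^ p^-1) `^ p by rewrite -powRrM mulVf ?gt_eqF// powRr1// ltW.
  apply: ge0_ler_powR; rewrite ?nnegrE ?powR_ge0 ?(ltW p0)//.
  by rewrite -(ger0_norm (u0 n)).
suff cl : {for l, continuous (@powR R ^~ p)} by exact: continuous_cvg cl ul.
apply: differentiable_continuous; apply/derivable1_diffP.
by apply: derivable_powR; rewrite in_itv/= l0.
Qed.

Lemma powR_normD a b p : 0 < p ->
  `|a + b| `^ p <= 2 `^ p * (`|a| `^ p + `|b| `^ p).
Proof.
move=> p0; have ab : `|a + b| <= 2 * Num.max `|a| `|b|.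
  rewrite (le_trans (ler_normD _ _))// mulr_natl mulr2n lerD//.
    by rewrite le_max lexx.
  by rewrite le_max lexx orbT.
have m0 : 0 <= 2 * Num.max `|a| `|b| by rewrite mulr_ge0// le_max normr_ge0.
apply: le_trans (ge0_ler_powR (ltW p0) (normr_ge0 _) m0 ab) _.
rewrite powRM// ?le_max ?normr_ge0// ler_wpM2l ?powR_ge0//.
by case: (leP `|a| `|b|) => _; rewrite ?lerDl ?lerDr powR_ge0.
Qed.

(** For y > M, y = y^p / y^(p-1) <= y^p / M^(p-1). This is uniform integrability in quantitative
    form: an L^p bound makes the part above M small as M grows, when p > 1. *)
Lemma le_min_powR y M p : 0 <= y -> 0 < M -> 1 <= p ->
  y <= Num.min y M + y `^ p / M `^ (p - 1).
Proof.
move=> y0 M0 p1; case: (leP y M) => [_|My].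
  by rewrite lerDl divr_ge0 ?powR_ge0.
have yM : y <= y `^ p / M `^ (p - 1).
  rewrite ler_pdivlMr ?powR_gt0// -(mulr_powRB1 y0 (lt_le_trans ltr01 p1)).
  rewrite ler_wpM2l// ge0_ler_powR ?nnegrE ?subr_ge0// ltW//.
by rewrite (le_trans yM)// lerDr ltW.
Qed.

Lemma le_1_powR y p : 0 <= y -> 1 <= p -> y <= 1 + y `^ p.
Proof.
move=> y0 p1; have := le_min_powR y0 ltr01 p1.
by rewrite powR1 divr1 => /le_trans; apply; rewrite lerD2r ge_min lexx orbT.
Qed.
End Powers.

(** * Comparison of Riesz variations *)

Section RieszTransfer.
Variables (R : realType) (p : R).
Hypothesis p1 : 1 <= p.

Lemma itv_partition_bounds (T : R) s i : itv_partition 0 T s ->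
  (i < size s)%N -> [/\ nth 0 (0 :: s) i \in `[0, T], nth 0 s i \in `[0, T] &
    nth 0 (0 :: s) i < nth 0 s i].
Proof.
move=> [ps /eqP lT] i_s.
have s_sorted : sorted <%R (0 :: s) by [].
have le_nth j k : (j <= k)%N -> (k <= size s)%N -> nth 0 (0 :: s) j <= nth 0 (0 :: s) k.
  move=> jk ks; have := sorted_leq_nth le_trans lexx 0 (sub_sorted (@ltW _ _) s_sorted).
  by apply => //; rewrite inE/= ltnS// (leq_trans jk).
have n0 : nth 0 (0 :: s) 0 = 0 by [].
have nT : nth 0 (0 :: s) (size s) = T by rewrite -lT (last_nth 0).
have mem_nth j : (j <= size s)%N -> nth 0 (0 :: s) j \in `[0, T].
  move=> js; rewrite in_itv/=; apply/andP; split; first by rewrite -[leLHS]n0 le_nth.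
  by rewrite -[leRHS]nT le_nth.
split; [exact/mem_nth/ltnW|exact: (mem_nth i.+1)|].
by move/pathP : ps; apply.
Qed.

Lemma riesz_sum_le (T K : R) (E E' : Type) (rho : E -> E -> R)
    (rho' : E' -> E' -> R) f f' s : 0 <= K -> itv_partition 0 T s ->
  (forall x y, x \in `[0, T] -> y \in `[0, T] ->
     [/\ 0 <= rho (f x) (f y), 0 <= rho' (f' x) (f' y) &
         rho' (f' x) (f' y) <= K * rho (f x) (f y)]) ->
  riesz_sum p rho' f' s <= K `^ p * riesz_sum p rho f s.
Proof.
move=> K0 sT fK; rewrite /riesz_sum mulr_sumr; apply: ler_sum => i _.
have [xT yT _] := itv_partition_bounds sT (ltn_ord i).
have [r0 r'0 r'r] := fK _ _ xT yT.
rewrite mulrA ler_wpM2r ?invr_ge0 ?powR_ge0// -powRM//.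
apply: ge0_ler_powR; rewrite ?nnegrE ?mulr_ge0//.
exact: le_trans p1.
Qed.

(** Serves to pass from F to a support function, with K = [norm1 u], and from a vector function to a
    coordinate, with K = 1. *)
Lemma riesz_variation_transfer (T K : R) (E E' : Type) (rho : E -> E -> R)
    (rho' : E' -> E' -> R) f f' : 0 <= K ->
  (forall x y, x \in `[0, T] -> y \in `[0, T] ->
     [/\ 0 <= rho (f x) (f y), 0 <= rho' (f' x) (f' y) &
         rho' (f' x) (f' y) <= K * rho (f x) (f y)]) ->
  (riesz_variation T p rho f < +oo)%E -> (riesz_variation T p rho' f' < +oo)%E.
Proof.
move=> K0 fK fV.
apply: (@le_lt_trans _ _ ((K `^ p)%:E * riesz_variation T p rho f)%E); last first.
  by rewrite lte_mul_pinfty ?lee_fin ?powR_ge0.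
apply: ge_ereal_sup => _ [s sT <-].
apply: (@le_trans _ _ (K `^ p * riesz_sum p rho f s)%:E).
  by rewrite lee_fin (riesz_sum_le K0 sT fK).
rewrite EFinM lee_wpmul2l ?lee_fin ?powR_ge0//.
by apply: ereal_sup_ubound; exists s.
Qed.

(** Appending T to a partition of [0, T'] adds one nonnegative term. *)
Lemma riesz_variation_restrict (T T' : R) (E : Type) (rho : E -> E -> R) f :
  T' <= T -> (riesz_variation T' p rho f <= riesz_variation T p rho f)%E.
Proof.
rewrite le_eqVlt => /predU1P[->//|T'T].
apply: ge_ereal_sup => _ [s [ps /eqP sT'] <-].
apply: (@le_trans _ _ (riesz_sum p rho f (rcons s T))%:E); last first.
  apply: ereal_sup_ubound; exists (rcons s T) => //; split; last by rewrite last_rcons.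
  by rewrite rcons_path ps/= sT'.
rewrite lee_fin /riesz_sum size_rcons big_ord_recr/=.
rewrite -[leLHS]addr0 lerD ?divr_ge0 ?powR_ge0//.
rewrite le_eqVlt; apply/orP; left; apply/eqP; apply: eq_bigr => i _ /=.
by rewrite -rcons_cons !nth_rcons/= ltn_ord ltnS (ltnW (ltn_ord i)).
Qed.
End RieszTransfer.

(** * Limits of the slopes and Fatou's lemma *)

Section StepConvergence.
Variables (R : realType) (T : R).
Hypothesis T_gt0 : 0 < T.
Notation mu := (@lebesgue_measure R).

(** The errors at the two grid points around t are at most e times their distances to t, and these
    distances add up to the mesh. *)
Lemma cvg_step q t l : 0 <= t < T -> derives_within T q t l ->
  step T q n t @[n --> \oo] --> l.
Proof.
move=> tT ql; apply/cvgrPdist_le => e e0.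
have [r r0 rP] := ql _ e0.
exists (Num.truncn (T / r)).+1 => // n /= Trn.
have [i iN /andP[it ti]] := grid_piece T_gt0 n tT.
rewrite (step_piece T_gt0 q iN) ?it//.
have mn := mesh_gt0 T_gt0 n.
have mr : mesh T n < r.
  rewrite /mesh ltr_pdivrMr// mulrC -ltr_pdivrMr//.
  have /truncn_itv/andP[_ /lt_le_trans] : 0 <= T / r by rewrite divr_ge0 ?ltW.
  by apply; rewrite ler_nat ltnS ltnW.
have x0 j : (j <= n.+1)%N -> grid T n j \in `[0, T].
  move=> jn; rewrite in_itv/= grid_ge0//=.
  by rewrite -[X in _ <= X](grid_last T n) ler_grid.
have hS := gridS T n i.
have [d1 d2] : `|grid T n i.+1 - t| = grid T n i.+1 - t /\ `|grid T n i - t| = t - grid T n i.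
  by split; [rewrite gtr0_norm ?subr_gt0|rewrite distrC ger0_norm ?subr_ge0].
have [Hi Hi1] : `|grid T n i - t| < r /\ `|grid T n i.+1 - t| < r.
  by rewrite d1 d2; split; lra.
have := rP _ (x0 i.+1 iN) Hi1; have := rP _ (x0 i (ltnW iN)) Hi.
rewrite d1 d2 => H1 H2; rewrite distrC /slope.
have -> : (q (grid T n i.+1) - q (grid T n i)) / mesh T n - l =
    (q (grid T n i.+1) - q (grid T n i) - mesh T n * l) / mesh T n.
  by field; rewrite gt_eqF.
rewrite normrM normfV (gtr0_norm mn) ler_pdivrMr//.
by move: H1 H2; rewrite !ler_norml hS; lra.
Qed.

Lemma measurable_derives_within q g :
  (forall t, t \in `[0, T] -> derives_within T q t (g t)) ->
  measurable_fun `[0, T] g.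
Proof.
move=> qg; apply/measurable_fun_itv_bndo_bndcP.
apply: (measurable_fun_cvg (h := step T q)) => [n|t].
  exact: measurable_step.
rewrite /= in_itv/= => tT; apply: cvg_step => //.
by apply: qg; rewrite in_itv/=; case/andP : tT => -> /ltW ->.
Qed.

Lemma integral_derives_within_powR q g p : 0 < p ->
  (forall t, t \in `[0, T] -> derives_within T q t (g t)) ->
  (\int[mu]_(t in `[0%R, T]) (`|g t| `^ p)%:E <=
   riesz_variation T p (fun x y : R => `|x - y|%R) q)%E.
Proof.
move=> p0 qg.
have mpow (h : R -> R) D : measurable_fun D h ->
    measurable_fun D (fun t => (`|h t| `^ p)%:E).
  move=> mh; apply/measurable_EFinP; apply: (measurableT_comp (measurable_powR p)).
  exact: measurableT_comp.
have mg := measurable_derives_within qg.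
rewrite -integral_itv_bndo_bndc; last first.
  by apply: mpow; exact/measurable_fun_itv_bndo_bndcP.
have mT : measurable `[0, T[%classic by [].
have fn0 n t : `[0, T[%classic t -> (0 <= (`|step T q n t| `^ p)%:E)%E.
  by rewrite lee_fin powR_ge0.
have fat := @fatou _ _ _ mu _ mT _ (fun n => mpow _ _ (@measurable_step R T q n _)) fn0.
apply: le_trans (le_trans _ fat) _.
  rewrite le_eqVlt; apply/orP; left; apply/eqP; apply: eq_integral => t.
  rewrite inE/= in_itv/= => tT.
  have qgt : derives_within T q t (g t).
    by apply: qg; rewrite in_itv/=; case/andP : tT => -> /ltW ->.
  have gcvg : (`|step T q n t| `^ p)%:E @[n --> \oo] --> (`|g t| `^ p)%:E.
    apply: cvg_EFin; first exact: nearW.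
    apply: cvg_powR => //.
    exact: cvg_norm (cvg_step tT qgt).
  by apply/esym; rewrite is_cvg_limn_einfE; [exact/cvg_lim|exact: cvgP gcvg].
rewrite limn_einf_lim; apply: lime_le; first exact: is_cvg_einfs.
apply: nearW => n; apply: le_trans (integral_step_powR T_gt0 q n p0).
rewrite -integral_itv_bndo_bndc; last by apply: mpow; exact: measurable_step.
by apply: ereal_inf_lbound; exists n => /=.
Qed.
End StepConvergence.

(** * Integrability of powers *)

Section PowerIntegrable.
Variables (R : realType).
Notation mu := (@lebesgue_measure R).
Implicit Types (D : set R) (f g : R -> R) (p : R).

Lemma measurable_powR_norm D f p :
  measurable_fun D f -> measurable_fun D (fun t => (`|f t| `^ p)%:E).
Proof.
move=> mf; apply/measurable_EFinP; apply: (measurableT_comp (measurable_powR p)).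
exact: measurableT_comp.
Qed.

Lemma integrable_cst_lty D (c : R) : measurable D -> (mu D < +oo)%E ->
  mu.-integrable D (EFin \o cst c).
Proof.
move=> mD Doo; apply/integrableP; split; first exact/measurable_EFinP.
have -> : (\int[mu]_(x in D) `|(EFin \o cst c) x| =
    \int[mu]_(x in D) cst (`|c|%:E) x)%E by [].
by rewrite integral_cst// lte_mul_pinfty.
Qed.

Lemma integrable_EFinB D f g : measurable D -> mu.-integrable D (EFin \o f) ->
  mu.-integrable D (EFin \o g) -> mu.-integrable D (EFin \o (fun t => f t - g t)).
Proof.
move=> mD fi gi; have -> : EFin \o (fun t => f t - g t) = ((EFin \o f) \- (EFin \o g))%E by [].
exact: integrableB.
Qed.

Lemma integrable_EFinD D f g : measurable D -> mu.-integrable D (EFin \o f) ->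
  mu.-integrable D (EFin \o g) -> mu.-integrable D (EFin \o (fun t => f t + g t)).
Proof.
move=> mD fi gi; have -> : EFin \o (fun t => f t + g t) = ((EFin \o f) \+ (EFin \o g))%E by [].
exact: integrableD.
Qed.

Lemma integral_powR_add D f g p : 0 < p -> measurable D ->
  measurable_fun D f -> measurable_fun D g ->
  (\int[mu]_(t in D) (`|f t + g t| `^ p)%:E <= (2 `^ p)%:E *
   (\int[mu]_(t in D) (`|f t| `^ p)%:E + \int[mu]_(t in D) (`|g t| `^ p)%:E))%E.
Proof.
move=> p0 mD mf mg.
rewrite -ge0_integralD//; [|exact: measurable_powR_norm..].
rewrite -ge0_integralZl_EFin ?powR_ge0//; last first.
  by apply: emeasurable_funD; exact: measurable_powR_norm.
  by move=> t _; rewrite adde_ge0 ?lee_fin ?powR_ge0.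
apply: ge0_le_integral => //.
- by apply: measurable_powR_norm; exact: measurable_funD.
- by apply: measurable_funeM; apply: emeasurable_funD; exact: measurable_powR_norm.
- by move=> t _; rewrite -EFinD -EFinM lee_fin powR_normD.
Qed.

Lemma integrable_powR D f p : 1 <= p -> measurable D -> (mu D < +oo)%E ->
  measurable_fun D f -> (\int[mu]_(t in D) (`|f t| `^ p)%:E < +oo)%E ->
  mu.-integrable D (EFin \o f).
Proof.
move=> p1 mD Doo mf fp; apply/integrableP; split; first exact/measurable_EFinP.
apply: (@le_lt_trans _ _ (\int[mu]_(t in D) (1%:E + (`|f t| `^ p)%:E))%E).
  apply: ge0_le_integral => //.
  - by apply: measurableT_comp => //; exact/measurable_EFinP.
  - by apply: emeasurable_funD => //; exact: measurable_powR_norm.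
  - by move=> t _; rewrite -EFinD lee_fin le_1_powR.
rewrite ge0_integralD//; [|exact: measurable_powR_norm].
by rewrite integral_cst// mul1e lte_add_pinfty.
Qed.
End PowerIntegrable.

(** * The fundamental theorem for functions of finite Riesz variation *)

Section RieszFTC.
Variables (R : realType) (T : R).
Hypothesis T_gt0 : 0 < T.
Notation mu := (@lebesgue_measure R).

Lemma lebesgue_measure_itvcc_lty (a b : R) : (mu `[a, b] < +oo)%E.
Proof. by rewrite lebesgue_measure_itv/=; case: ifPn => _; rewrite ?ltry// -EFinB ltry. Qed.

(* For [p > 1] the step functions with the slopes of [q] are bounded in L^p, hence
   uniformly integrable, so that their integrals converge to that of their pointwise
   limit. *)
Lemma riesz_FTC (q psi : R -> R) p : 1 < p ->
  (riesz_variation T p (fun x y : R => `|x - y|%R) q < +oo)%E ->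
  measurable_fun `[0, T] psi ->
  (\int[mu]_(t in `[0%R, T]) (`|psi t| `^ p)%:E < +oo)%E ->
  {ae mu, forall t, t \in `[0, T] -> derives_within T q t (psi t)} ->
  q T - q 0 = \int[mu]_(t in `[0, T]) psi t.
Proof.
move=> p1 qV mpsi psiV qpsi; have p0 : 0 < p := lt_trans ltr01 p1.
have mT : measurable `[0, T]%classic by [].
have muT := lebesgue_measure_itvcc_lty 0 T.
pose D (n : nat) (t : R) : R := `|step T q n t - psi t|.
have mD n : measurable_fun `[0, T] (D n).
  by apply: measurableT_comp => //; apply: measurable_funB => //; exact: measurable_step.
have [C C0 DC] : exists2 C : R, 0 <= C &
    forall n, (\int[mu]_(t in `[0%R, T]) (D n t `^ p)%:E <= C%:E)%E.
  pose S : \bar R := ((2 `^ p)%:E * (riesz_variation T p (fun x y : R => `|x - y|%R) q +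
     \int[mu]_(t in `[0%R, T]) (`|psi t| `^ p)%:E))%E.
  have SD n : (\int[mu]_(t in `[0%R, T]) (D n t `^ p)%:E <= S)%E.
    have mN : measurable_fun `[0, T] (fun t => - psi t) by exact: measurable_funN.
    apply: le_trans (integral_powR_add p0 mT (@measurable_step _ T q n _) mN) _.
    under [X in (_ * (_ + X) <= _)%E]eq_integral do rewrite normrN.
    by rewrite lee_pmul2l// ?lte_fin ?powR_gt0// leeD2r// integral_step_powR.
  have S0 : (0 <= S)%E.
    by apply: le_trans (SD 0); apply: integral_ge0 => t _; rewrite lee_fin powR_ge0.
  have Sfin : S \is a fin_num.
    by rewrite ge0_fin_numE// lte_mul_pinfty ?lee_fin ?powR_ge0// lte_add_pinfty.
  by exists (fine S); [exact: fine_ge0|move=> n; rewrite fineK].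
have ipsi : mu.-integrable `[0, T] (EFin \o psi).
  exact: (integrable_powR (ltW p1)).
have istep n : mu.-integrable `[0, T] (EFin \o step T q n).
  apply: (@integrable_powR R `[0, T] (step T q n) p (ltW p1) mT muT).
    exact: measurable_step.
  exact: le_lt_trans (integral_step_powR T_gt0 q n p0) qV.
have X_le n : (`|q T - q 0 - \int[mu]_(t in `[0, T]) psi t|%:E <=
    \int[mu]_(t in `[0%R, T]) (D n t)%:E)%E.
  have -> : q T - q 0 = \int[mu]_(t in `[0, T]) step T q n t.
    by rewrite /Rintegral integral_step.
  rewrite -RintegralB//.
  have iB : mu.-integrable `[0, T] (EFin \o (fun t => step T q n t - psi t)).
    exact: integrable_EFinB.
  rewrite EFin_normr_Rintegral//.
  exact: (le_abse_integral mu mT (measurable_int mu iB)).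
set X := `|_ - _ - _| in X_le.
(* [D n] is cut at height M: the truncation has integral tending to 0 by dominated convergence, and
   the rest is controlled by the L^p bound C through [le_min_powR]. *)
have XM M e : 0 < M -> 0 < e -> X <= e + C / M `^ (p - 1).
  move=> M0 e0; pose m (n : nat) (t : R) : R := Num.min (D n t) M.
  have mm n : measurable_fun `[0, T] (fun t => (m n t)%:E).
    by apply/measurable_EFinP; exact: measurable_minr.
  have m0 n t : 0 <= m n t by rewrite le_min normr_ge0 ltW.
  have Dm n : (\int[mu]_(t in `[0%R, T]) (D n t)%:E <=
      \int[mu]_(t in `[0%R, T]) (m n t)%:E + (C / M `^ (p - 1))%:E)%E.
    have mDp : measurable_fun `[0, T] (fun t => (D n t `^ p)%:E).
      by apply: measurable_powR_norm; apply: measurable_funB => //; exact: measurable_step.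
    apply: (@le_trans _ _ (\int[mu]_(t in `[0%R, T])
        ((m n t)%:E + (M `^ (p - 1))^-1%:E * (D n t `^ p)%:E))%E).
      apply: ge0_le_integral => //.
      - by move=> t _; rewrite lee_fin normr_ge0.
      - apply/measurable_EFinP. exact: mD.
      - by apply: emeasurable_funD; [exact: mm|exact: measurable_funeM].
      - move=> t _; rewrite -EFinM -EFinD lee_fin mulrC.
        exact: le_min_powR (normr_ge0 _) M0 (ltW p1).
    rewrite ge0_integralD//=; last 4 first.
    - by move=> t _; rewrite lee_fin.
    - exact: mm.
    - by move=> t _; rewrite -EFinM lee_fin mulr_ge0 ?invr_ge0 ?powR_ge0.
    - exact: measurable_funeM.
    rewrite ge0_integralZl_EFin ?invr_ge0 ?powR_ge0//; last first.
      by move=> t _; rewrite lee_fin powR_ge0.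
    by rewrite leeD2l// mulrC EFinM lee_wpmul2l ?lee_fin ?invr_ge0 ?powR_ge0.
  have cm : (\int[mu]_(t in `[0%R, T]) (m n t)%:E)%E @[n --> \oo] --> 0%:E.
    have Mint : mu.-integrable `[0, T] (cst M%:E).
      apply/integrableP; split => //.
      by rewrite integral_cst//= lte_mul_pinfty.
    have m_cvg : {ae mu, forall t, `[0, T]%classic t ->
        (m n t)%:E @[n --> \oo] --> (cst 0%E : R -> \bar R) t}.
      (* The step functions all vanish at T, so this point is left out. *)
      have neT : {ae mu, forall t, t != T}.
        exists [set T]; split => //; first exact: lebesgue_measure_set1.
        by move=> t /= /negP; rewrite negbK => /eqP.
      apply: filterS2 qpsi neT; first exact: (ae_filter_ringOfSetsType mu).
      move=> t qt tT /= t0T.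
      apply: cvg_EFin; first exact: nearW.
      apply: (@squeeze_cvgr _ _ _ _ (cst 0) (D ^~ t)); last 2 first.
      - exact: cvg_cst.
      - rewrite /D -[X in _ --> X](normr0 R) -(subrr (psi t)).
        apply: cvg_norm; apply: cvgB; last exact: cvg_cst.
        apply: cvg_step => //; last exact: qt.
        by move: t0T; rewrite in_itv/= lt_neqAle tT.
      - by apply: nearW => n; rewrite m0 ge_min lexx.
    have mM : {ae mu, forall t n, `[0, T]%classic t -> (`|(m n t)%:E| <= (cst M%:E) t)%E}.
      by apply: aeW => t n _; rewrite /= lee_fin ger0_norm// ge_min lexx orbT.
    have mc : measurable_fun `[0, T] (cst 0%E : R -> \bar R) by exact: measurable_cst.
    have [_ _] := @dominated_convergence _ _ _ mu _ mT _ _ _ mm mc m_cvg Mint mM.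
    by rewrite integral0.
  have nb : nbhs (0%:E : \bar R) [set x | (x < e%:E)%E].
    by apply: open_ereal_lt'; rewrite lte_fin.
  have [n _ nP] := cm _ nb.
  have := le_trans (X_le n) (le_trans (Dm n) (leeD2r _ (ltW (nP n (leqnn n))))).
  by rewrite -EFinD lee_fin.
apply/eqP; rewrite -subr_eq0 -normr_le0 -/X leNgt; apply/negP => X0.
(* M is chosen with M^(p-1) = 3 C / X + 1, so that the tail is at most X / 3; with e = X / 3 this
   gives X <= 2 X / 3. *)
have k0 : 0 < 3 * C / X + 1 by rewrite ltr_wpDl// divr_ge0 ?mulr_ge0// ltW.
have p10 : p - 1 != 0 by rewrite subr_eq0 gt_eqF.
have := XM ((3 * C / X + 1) `^ (p - 1)^-1) (X / 3) (powR_gt0 _ k0) _.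
rewrite -powRrM mulVf// powRr1 ?(ltW k0)//; rewrite divr_gt0// => /(_ isT).
have -> : C / (3 * C / X + 1) = C * X / (3 * C + X).
  by field; rewrite !gt_eqF//; lra.
have : C * X / (3 * C + X) <= X / 3.
  by rewrite ler_pdivrMr; [nra|lra].
lra.
Qed.
End RieszFTC.

(** * Integrating functions bounded by a derivative *)

Lemma derivable_derives_within (R : realType) (T t : R) (f : R -> R) :
  derivable f t 1 -> derives_within T f t (derive1 f t).
Proof.
move=> df e e0; rewrite derive1E.
have /cvgrPdist_le/(_ _ e0)[r /= r0 rP] := df.
exists r => // s _ st; have [->|s_t] := eqVneq s t.
  by rewrite !subrr mul0r subr0 normr0 mulr0.
have st0 : s - t != 0 by rewrite subr_eq0.
have := rP (s - t); rewrite /ball_/= sub0r normrN => /(_ st st0).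
rewrite [_%:A]mulr1 subrK distrC => H.
have -> : f s - f t - (s - t) * 'D_1 f t =
    (s - t) * ((s - t)^-1 *: (f s - f t) - 'D_1 f t).
  by rewrite /GRing.scale/=; field.
by rewrite normrM mulrC ler_wpM2r.
Qed.

Lemma derives_within_restrict (R : realType) (T T' t l : R) (f : R -> R) :
  T' <= T -> derives_within T f t l -> derives_within T' f t l.
Proof.
move=> TT fl e /fl[r r0 rP]; exists r => // s; rewrite in_itv/= => /andP[s0 sT].
by apply: rP; rewrite in_itv/= s0 (le_trans sT).
Qed.

(** Each point is compared only with its neighbours, never two neighbours with each other. For S the
    set where h is at least h 0, the comparison on the left puts sup S into S, and the one on the
    right pushes S beyond sup S unless it equals T. *)
Lemma locally_increasing_le (R : realType) (T : R) (h : R -> R) : 0 <= T ->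
  (forall x, x \in `[0, T] -> exists2 r, 0 < r & forall y, y \in `[0, T] ->
     `|y - x| < r -> (y <= x -> h y <= h x) /\ (x <= y -> h x <= h y)) ->
  h 0 <= h T.
Proof.
move=> T0 hloc; pose S := [set x | x \in `[0, T] /\ h 0 <= h x].
have S0 : S 0 by split; rewrite ?in_itv/= ?lexx.
have Sub : ubound S T by move=> x [] /[!in_itv]/= /andP[].
have hsS : has_sup S by split; [exists 0|exists T].
have s0 : 0 <= sup S by exact: ub_le_sup hsS.2 _ S0.
have sT : sup S <= T by apply: ge_sup => //; exists 0.
have sI : sup S \in `[0, T] by rewrite in_itv/= s0.
have [r r0 rP] := hloc _ sI.
have hs : h 0 <= h (sup S).
  have [x [xI hx] xs] := sup_adherent r0 hsS.
  have xS : x <= sup S by exact: ub_le_sup hsS.2 _ (conj xI hx).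
  have xr : `|x - sup S| < r by rewrite distrC ger0_norm ?subr_ge0//; lra.
  by have [/(_ xS) + _] := rP x xI xr; exact: le_trans.
move: sT; rewrite le_eqVlt => /predU1P[<-//|sT].
pose y := Num.min T (sup S + r / 2).
have sy : sup S < y by rewrite lt_min sT ltrDl divr_gt0.
have yI : y \in `[0, T] by rewrite in_itv/= (le_trans s0 (ltW sy))/= ge_min lexx.
have yr : `|y - sup S| < r.
  rewrite gtr0_norm ?subr_gt0// ltrBlDl gt_min; apply/orP; right.
  by rewrite ltrD2l ltr_pdivrMr// ltr_pMr// ltr1n.
have [_ /(_ (ltW sy)) hy] := rP y yI yr.
have Sy : S y by split=> //; exact: le_trans hs hy.
by have := ub_le_sup hsS.2 Sy; rewrite leNgt sy.
Qed.

(** * An increasing function with infinite derivative on a null set *)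

Section NullSetDominator.
Variable R : realType.
Notation mu := (@lebesgue_measure R).

Lemma negligible_open_cover (N : set R) (e : R) : mu.-negligible N -> 0 < e ->
  exists U : set R, [/\ open U, N `<=` U & (mu U <= e%:E)%E].
Proof.
move=> [A [mA A0 NA]] e0.
have A_fin : (mu A < +oo)%E by rewrite A0 ltry.
have [U [oU AU Ue]] := lebesgue_regularity_outer mA A_fin e0.
exists U; split=> //; first exact: subset_trans NA AU.
have mU : measurable U by exact: open_measurable.
have mUA : measurable (U `\` A) by exact: measurableD.
have : (mu (A `|` (U `\` A)) <= mu A + mu (U `\` A))%E by exact: measureU2.
by rewrite setDUK// A0 add0e => /le_trans; apply; exact: ltW.
Qed.

(* [psi x] sums the measures of [U k `&` `[0, x]], where the open sets [U k] cover [N]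
   and have total measure at most [eta]; it has infinite derivative on [N]. *)
Lemma null_set_dominator (N : set R) (eta : R) : mu.-negligible N -> 0 < eta ->
  exists psi : R -> R,
    [/\ {homo psi : x y / x <= y}, forall x y, psi y - psi x <= eta &
     forall x K, N x -> exists2 r, 0 < r & forall y, 0 <= x -> 0 <= y ->
       `|y - x| < r ->
       (y <= x -> K * (x - y) <= psi x - psi y) /\
       (x <= y -> K * (y - x) <= psi y - psi x)].
Proof.
move=> N0 eta0.
have e0 k : 0 < eta / (2 ^ k.+1)%:R by rewrite divr_gt0// ltr0n expn_gt0.
have /(_ _)/cid-/all_sig[U UP] k := negligible_open_cover N0 (e0 k).
have oU k : open (U k) by case: (UP k).
have mU k : measurable (U k) by exact: open_measurable.
pose S (A : set R) : \bar R := (\sum_(k <oo) mu (U k `&` A))%E.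
have S_ge0 A : (0 <= S A)%E by exact: nneseries_ge0.
have SU A B : measurable A -> measurable B -> [disjoint A & B] ->
    S (A `|` B) = (S A + S B)%E.
  move=> mA mB AB; rewrite /S -nneseriesD//.
  apply: eq_eseriesr => k _; rewrite setIUr measureU//;
    [exact: (measurableI _ _ (mU k))|exact: (measurableI _ _ (mU k))|].
  by rewrite setIACA setIid (eqP AB) setI0.
have S_le A : measurable A -> (S A <= eta%:E)%E.
  move=> mA; apply: le_trans (epsilon_trick0 xpredT (ltW eta0)).
  apply: lee_nneseries => // k _; case: (UP k) => _ _; apply: le_trans.
  by apply: le_measure; rewrite ?inE;
    [exact: (measurableI _ _ (mU k) mA)|exact: mU|exact: subIsetl].
have S_fin A : measurable A -> S A \is a fin_num.
  by move=> mA; rewrite ge0_fin_numE// (le_lt_trans (S_le A mA))// ltry.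
pose psi (x : R) : R := fine (S `[0, x]%classic).
have psiD x y : 0 <= x -> x <= y -> psi y = psi x + fine (S `]x, y]%classic).
  move=> x0 xy; rewrite /psi -fineD ?S_fin// -SU//.
    by rewrite -itv_bndbnd_setU// bnd_simp.
  by apply/disj_setPS => z [/=]; rewrite !in_itv/= => /andP[_ zx] /andP[]; rewrite ltNge zx.
have psi_ge0 x : 0 <= psi x by rewrite fine_ge0.
exists psi; split.
- move=> x y xy; have [x0|x0] := leP 0 x; first by rewrite (psiD x y)// lerDl fine_ge0.
  (* For x < 0 the interval [0, x] is empty and psi x = 0. *)
  by rewrite {1}/psi set_itv_ge ?bnd_simp -?ltNge// /S;
     under eq_eseriesr do rewrite setI0 measure0; rewrite eseries0.
- move=> x y; rewrite lerBlDr ler_wpDr// -lee_fin /psi fineK ?S_fin//.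
  exact: S_le.
- move=> x K Nx.
  (* A ball around x lies in each of the first [Num.bound] of |K| sets U k. An interval inside it is
     counted in full by each of them, so psi grows there at rate at least |K|. *)
  have [r r0 rU] : exists2 r, 0 < r &
      forall k y, (k < Num.bound `|K|)%N -> `|y - x| < r -> U k y.
    elim: (Num.bound `|K|) => [|n [r r0 rU]]; first by exists 1.
    have : nbhs x (U n) by apply: open_nbhs_nbhs; split=> //; case: (UP n) => _ + _; apply.
    move=> [r' /= r'0 r'U]; exists (Num.min r r'); first by rewrite lt_min r0.
    move=> k y; rewrite ltnS leq_eqVlt lt_min => /predU1P[->|kn] /andP[yr yr'].
      by apply: r'U; rewrite /= distrC.
    exact: rU.
  have grow a b : 0 <= a -> a <= b -> (forall y, a < y <= b -> `|y - x| < r) ->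
      K * (b - a) <= psi b - psi a.
    move=> a0 ab abr; rewrite (psiD a b)// addrAC subrr add0r.
    rewrite -lee_fin fineK ?S_fin//.
    apply: le_trans (nneseries_lim_ge (Num.bound `|K|) _) => //.
    rewrite (eq_big_nat _ _ (F2 := fun=> (b - a)%:E)) => [|k /andP[_ kK]].
      rewrite sumEFin lee_fin big_const_nat subn0 iter_addr_0 -mulr_natl.
      apply: ler_wpM2r; first by rewrite subr_ge0.
      exact: le_trans (ler_norm K) (ltW (archi_boundP (normr_ge0 K))).
    rewrite setIidr => [|y /=]; last by rewrite in_itv/= => /abr; exact: rU.
    rewrite lebesgue_measure_itv/= lte_fin; move: ab; rewrite le_eqVlt => /predU1P[->|->].
      by rewrite ltxx subrr.
    by rewrite EFinB.
  exists r => // y x0 y0 yx; split=> xy; apply: grow => // z /andP[].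
    move=> yz zx; rewrite distrC ger0_norm ?subr_ge0//.
    by move: yx; rewrite distrC ger0_norm ?subr_ge0//; lra.
  move=> xz zy; rewrite gtr0_norm ?subr_gt0//.
  by move: yx; rewrite ger0_norm ?subr_ge0//; lra.
Qed.
End NullSetDominator.

Section IntegralFunction.
Variables (R : realType) (T : R) (phi : R -> R).
Notation mu := (@lebesgue_measure R).
Hypothesis iphi : mu.-integrable `[0, T] (EFin \o phi).

Lemma integrable_sub_itv (x : R) : x <= T -> mu.-integrable `[0, x] (EFin \o phi).
Proof.
move=> xT; apply: integrableS iphi => // y /=; rewrite !in_itv/= => /andP[-> yx].
exact: le_trans yx xT.
Qed.

Lemma Rintegral_increment (x y : R) : 0 <= x -> x <= y -> y <= T ->
  \int[mu]_(t in `[0, y]) phi t - \int[mu]_(t in `[0, x]) phi t =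
  \int[mu]_(t in `]x, y]) phi t.
Proof.
move=> x0 xy yT; apply: Rintegral_itvB; first exact: integrable_sub_itv.
  by rewrite bnd_simp.
by rewrite bnd_simp.
Qed.

Lemma ae_derivable_integral :
  {ae mu, forall t : R, t \in `]0, T[ ->
     derivable (fun x : R => \int[mu]_(s in `[0, x]) phi s) t 1 /\
     derive1 (fun x : R => \int[mu]_(s in `[0, x]) phi s) t = phi t}.
Proof.
(* Extension by zero makes phi integrable on the whole line; around a point of ]0, T[ the two
   indefinite integrals coincide. *)
pose f : R -> R := phi \_ `[0, T].
have fi : mu.-integrable setT (EFin \o f).
  have mI : measurable (`[0, T]%classic : set R) by [].
  rewrite /f -restrict_EFin.
  exact: (proj1 (@integrable_mkcond _ _ _ mu `[0, T]%classic (EFin \o phi) mI) iphi).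
have fi_sub (A : set R) : measurable A -> mu.-integrable A (EFin \o f).
  by move=> mA; apply: integrableS fi.
have floc : locally_integrable setT f.
  by apply: open_integrable_locally => //; exact: openT.
have := FTC1 (a := BLeft 0) (fun y : R => fi_sub _ (measurable_itv `[0, y])) floc.
apply: filterS; first exact: (ae_filter_ringOfSetsType mu).
move=> t ft; rewrite in_itv/= => /andP[t0 tT].
have [dF F't] := ft t0.
have nearF : {near t, (fun x : R => \int[mu]_(s in `[0, x]) f s) =1
    (fun x : R => \int[mu]_(s in `[0, x]) phi s)}.
  near=> x; apply: eq_Rintegral => s; rewrite inE/= in_itv/= => /andP[s0 sx].
  rewrite /f patchE mem_set//= in_itv/= s0 (le_trans sx)//.
  by apply: ltW; near: x; exact: lt_nbhsl.
split; first exact: near_eq_derivable nearF dF.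
rewrite derive1E -(near_eq_derive _ nearF) -derive1E F't /f patchE mem_set//=.
by rewrite in_itv/= !ltW.
Unshelve. all: by end_near. Qed.
End IntegralFunction.

Section DerivativeIntegral.
Variables (R : realType) (T : R).
Hypothesis T_gt0 : 0 < T.
Notation mu := (@lebesgue_measure R).

(* Where [q - int phi] may fail to have a nonnegative derivative, its difference
   quotients are still bounded below since [phi <= M], and a function with infinite
   derivative there compensates for them. *)
Lemma integral_le_derivative_bounded (q g phi : R -> R) (M : R) :
  (forall t, t \in `[0, T] -> derives_within T q t (g t)) ->
  mu.-integrable `[0, T] (EFin \o phi) ->
  (forall t, t \in `[0, T] -> phi t <= M) ->
  {ae mu, forall t, t \in `[0, T] -> phi t <= g t} ->
  \int[mu]_(t in `[0, T]) phi t <= q T - q 0.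
Proof.
move=> qg iphi phiM phig.
pose F (x : R) : R := \int[mu]_(s in `[0, x]) phi s.
have F0 : F 0 = 0 by rewrite /F set_itv1 Rintegral_set1.
have FM x y : 0 <= x -> x <= y -> y <= T -> F y - F x <= M * (y - x).
  move=> x0 xy yT; rewrite /F (Rintegral_increment iphi)//.
  have subxy : `]x, y]%classic `<=` `[0, T]%classic.
    move=> t /=; rewrite !in_itv/= => /andP[xt ty].
    by rewrite (le_trans x0 (ltW xt)) (le_trans ty yT).
  have muxy : fine (mu `]x, y]) = y - x.
    rewrite lebesgue_measure_itv/= lte_fin; move: xy.
    by rewrite le_eqVlt => /predU1P[->|->]; rewrite ?ltxx ?subrr// -EFinB.
  rewrite -muxy -Rintegral_cst//; apply: le_Rintegral => //.
  - exact: integrableS iphi.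
  - apply: integrable_cst_lty => //.
    by rewrite lebesgue_measure_itv/=; case: ifPn => _; rewrite ?ltry// -EFinB ltry.
  - by move=> t /subxy; exact: phiM.
pose good (t : R) := (t \in `]0, T[ -> derivable F t 1 /\ derive1 F t = phi t) /\
  (t \in `[0, T] -> phi t <= g t).
have [N [N0 Ngood]] : exists N, mu.-negligible N /\
    forall t, t \in `[0, T] -> ~ N t ->
      [/\ derivable F t 1, derive1 F t = phi t & phi t <= g t].
  have : {ae mu, forall t, good t}.
    apply: filterS2 (ae_derivable_integral iphi) phig;
      first exact: (ae_filter_ringOfSetsType mu).
    by move=> t; split.
  (* The endpoints join N because [derivable] is two-sided. *)
  move=> goodae; exists ([set 0; T] `|` ~` [set t | good t]); split.
    apply: negligibleU; last exact: goodae.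
    have neg1 (x : R) : mu.-negligible [set x].
      by exists [set x]; split=> //; exact: lebesgue_measure_set1.
    exact: negligibleU.
  move=> t; rewrite in_itv/= => /andP[t0 tT] /not_orP[/not_orP[/eqP t_0 /eqP t_T]].
  move=> /contrapT[]; rewrite !in_itv/= lt_neqAle eq_sym t_0 t0 lt_neqAle t_T tT/=.
  by move=> /(_ isT)[] ? ? /(_ isT).
(* The summand eta is the total growth of psi and eta * T that of the linear term of h. *)
suff H eta : 0 < eta -> \int[mu]_(t in `[0, T]) phi t <= q T - q 0 + eta * (1 + T).
  apply/ler_addgt0Pr => e e0.
  have T10 : 0 < 1 + T by rewrite addr_gt0.
  by have := H (e / (1 + T)) (divr_gt0 e0 T10); rewrite divfK ?gt_eqF.
move=> eta0; have [psi [psi_mono psi_eta psiN]] := null_set_dominator N0 eta0.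
(* psi repairs the points of N; off N the linear term absorbs the two first-order errors, of q and
   of F. *)
pose h (x : R) : R := q x - F x + psi x + eta * x.
have : h 0 <= h T.
  apply: locally_increasing_le => [|x xI]; first exact: ltW.
  have := xI; rewrite in_itv/= => /andP[x0 xT].
  have [Nx|Nx] := pselect (N x).
    have [r1 r10 r1P] := qg _ xI 1 ltr01.
    (* Near x, q has slopes at least g x - 1 and F has slopes at most M, so q - F loses at most M +
       1 - g x per unit length. *)
    have [r2 r20 r2P] := psiN x (M + 1 - g x) Nx.
    exists (Num.min r1 r2); first by rewrite lt_min r10.
    move=> y yI; rewrite lt_min => /andP[yr1 yr2].
    have := yI; rewrite in_itv/= => /andP[y0 yT].
    have Hq := r1P y yI yr1; have [H1 H2] := r2P y x0 y0 yr2.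
    move: Hq; rewrite ler_norml => /andP[Hq1 Hq2].
    split=> xy; rewrite /h.
      have yxE : `|y - x| = x - y by rewrite distrC ger0_norm ?subr_ge0.
      have : 0 <= eta * (x - y) by rewrite mulr_ge0 ?subr_ge0// ltW.
      by have := H1 xy; have := FM y x y0 xy xT; rewrite yxE in Hq1 Hq2; lra.
    have yxE : `|y - x| = y - x by rewrite ger0_norm ?subr_ge0.
    have : 0 <= eta * (y - x) by rewrite mulr_ge0 ?subr_ge0// ltW.
    by have := H2 xy; have := FM x y x0 xy yT; rewrite yxE in Hq1 Hq2; lra.
  have [dF F'x phix] := Ngood x xI Nx.
  have eta2 : 0 < eta / 2 by rewrite divr_gt0.
  have [r1 r10 r1P] := qg _ xI _ eta2.
  have [r2 r20 r2P] := derivable_derives_within T dF eta2.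
  exists (Num.min r1 r2); first by rewrite lt_min r10.
  move=> y yI; rewrite lt_min => /andP[yr1 yr2].
  have := r1P y yI yr1; have := r2P y yI yr2; rewrite F'x !ler_norml.
  move=> /andP[F1 F2] /andP[q1 q2]; split=> xy; rewrite /h; have := psi_mono _ _ xy.
    have yxE : `|y - x| = x - y by rewrite distrC ger0_norm ?subr_ge0.
    have : 0 <= (g x - phi x) * (x - y) by rewrite mulr_ge0 ?subr_ge0.
    by rewrite yxE in F1 F2 q1 q2; lra.
  have yxE : `|y - x| = y - x by rewrite ger0_norm ?subr_ge0.
  have : 0 <= (g x - phi x) * (y - x) by rewrite mulr_ge0 ?subr_ge0.
  by rewrite yxE in F1 F2 q1 q2; lra.
rewrite /h F0; have := psi_eta 0 T; have := psi_eta T 0; rewrite -/(F T); lra.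
Qed.
End DerivativeIntegral.

(** * Almost everywhere comparison of integrals *)

Section AeEqIntegral.
Local Open Scope ereal_scope.
Variables (d : measure_display) (T : measurableType d) (R : realType).
Variables (mu : {measure set T -> \bar R}) (D : set T).
Import HBNNSimple.

(* Unlike their library counterparts, these lemmas assume no measurability: the
   integral of a nonnegative function is a supremum over simple functions, which may
   be cut off outside a null set. *)
Lemma nonmeasurable_ae_ge0_le_integral (f g : T -> \bar R) :
  (forall x, D x -> 0 <= f x) -> (forall x, D x -> 0 <= g x) ->
  {ae mu, forall x, D x -> f x <= g x} ->
  \int[mu]_(x in D) f x <= \int[mu]_(x in D) g x.
Proof.
move=> f0 g0 [N [mN N0 fgN]].
rewrite !ge0_integralE//; apply: ge_ereal_sup => _ [h /= hf <-].
have mNC : measurable (~` N) by exact: measurableC.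
pose h' := proj_nnsfun h mNC.
have -> : sintegral mu h = sintegral mu h'.
  rewrite -!integralT_nnsfun; apply: ae_eq_integral => //.
  - exact/measurable_EFinP.
  - exact/measurable_EFinP.
  exists N; split => // x /= /not_implyP[_]; apply: contra_notP => Nx.
  by rewrite /h' /= /mindic indicE mem_set ?mulr1.
apply: ereal_sup_ubound; exists h' => //= x.
rewrite /h' /= /mindic indicE /patch.
have [xN|xN] := boolP (x \in ~` N); last first.
  by rewrite mulr0; case: ifPn => // /set_mem; exact: g0.
rewrite mulr1; apply: le_trans (hf x) _; rewrite /patch; case: ifPn => // /set_mem Dx.
by apply: contrapT => fgx; move: xN; rewrite inE; apply; apply: fgN => /(_ Dx).
Qed.

Lemma nonmeasurable_ae_eq_integral (f g : T -> \bar R) :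
  ae_eq mu D f g -> \int[mu]_(x in D) f x = \int[mu]_(x in D) g x.
Proof.
have ge0 f' g' : (forall x, D x -> 0 <= f' x) -> (forall x, D x -> 0 <= g' x) ->
    ae_eq mu D f' g' -> \int[mu]_(x in D) f' x = \int[mu]_(x in D) g' x.
  move=> f0 g0 fg; apply/eqP; rewrite eq_le; apply/andP; split;
    apply: nonmeasurable_ae_ge0_le_integral => //; move: fg; apply: filterS;
    by [exact: (ae_filter_ringOfSetsType mu)|move=> x /[apply] ->].
move=> fg; rewrite integralE [RHS]integralE.
by have [fgp fgn] := (ae_eq_funeposneg _ _ _ _).1 fg; congr (_ - _); exact: ge0.
Qed.
End AeEqIntegral.

Section DerivativeIntegralUnbounded.
Variables (R : realType) (T : R).
Hypothesis T_gt0 : 0 < T.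
Notation mu := (@lebesgue_measure R).

(** Cutting phi from above only keeps it below g; the truncations are dominated by |phi| and at each
    point are eventually equal to phi. *)
Lemma integral_le_derivative (q g phi : R -> R) :
  (forall t, t \in `[0, T] -> derives_within T q t (g t)) ->
  mu.-integrable `[0, T] (EFin \o phi) ->
  {ae mu, forall t, t \in `[0, T] -> phi t <= g t} ->
  \int[mu]_(t in `[0, T]) phi t <= q T - q 0.
Proof.
move=> qg iphi phig; pose phi_ (n : nat) (t : R) : R := Num.min (phi t) n%:R.
have mT : measurable (`[0, T]%classic : set R) by [].
have mphi : measurable_fun `[0, T] phi.
  by apply/measurable_EFinP; exact: measurable_int iphi.
have mphi_ n : measurable_fun `[0, T] (EFin \o phi_ n).
  by apply/measurable_EFinP; exact: measurable_minr.
have phi_le n t : `|phi_ n t| <= `|phi t|.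
  rewrite /phi_; case: (leP (phi t) n%:R) => // nphi.
  by rewrite !ger0_norm// ?(le_trans _ (ltW nphi))// ltW.
have iphi_ n : mu.-integrable `[0, T] (EFin \o phi_ n).
  apply: (@le_integrable _ _ _ mu _ mT (EFin \o phi_ n) (EFin \o phi) (mphi_ n) _ iphi).
  by move=> t _; rewrite /= lee_fin.
have key n : \int[mu]_(t in `[0, T]) phi_ n t <= q T - q 0.
  apply: (integral_le_derivative_bounded T_gt0 qg (iphi_ n) (M := n%:R)).
    by move=> t _; rewrite ge_min lexx orbT.
  apply: filterS phig; first exact: (ae_filter_ringOfSetsType mu).
  by move=> t H /H; apply: le_trans; rewrite ge_min lexx.
have phi_cvg : {ae mu, forall t, `[0, T]%classic t ->
    (EFin \o phi_ n) t @[n --> \oo] --> (EFin \o phi) t}.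
  apply: aeW => t _; apply: cvg_near_cst.
  exists (Num.bound `|phi t|) => // n /= bn; rewrite /phi_; congr EFin.
  apply/min_idPl; rewrite (le_trans (ler_norm _))// ltW//.
  by rewrite (lt_le_trans (archi_boundP (normr_ge0 _)))// ler_nat.
have dom : {ae mu, forall t n, `[0, T]%classic t ->
    (`|(EFin \o phi_ n) t| <= (EFin \o (Num.norm \o phi)) t)%E}.
  by apply: aeW => t n _; rewrite /= lee_fin.
have inorm : mu.-integrable `[0, T] (EFin \o (Num.norm \o phi)).
  exact: integrable_norm.
have [_ _ icvg] := @dominated_convergence _ _ _ mu _ mT _ _ _ mphi_
  (measurable_int mu iphi) phi_cvg inorm dom.
rewrite -lee_fin /Rintegral fineK; last exact: integrable_fin_num.
rewrite -(cvg_lim _ icvg)//; apply: lime_le; first exact: cvgP icvg.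
apply: nearW => n; rewrite -[leLHS]fineK; last exact: integrable_fin_num.
by rewrite lee_fin; exact: key.
Qed.
End DerivativeIntegralUnbounded.

(** * Indefinite integrals *)

Section IntegralVariation.
Variable R : realType.
Notation mu := (@lebesgue_measure R).

(** Convexity of the power, as Young's inequality for y and m^(p-1) with exponents p and p/(p-1); p
    = 1, which has no finite conjugate exponent, is separate. *)
Lemma powR_tangent (p y m : R) : 1 <= p -> 0 <= y -> 0 <= m ->
  m `^ p + p * m `^ (p - 1) * (y - m) <= y `^ p.
Proof.
move=> p1 y0 m0; have p0 : 0 < p := lt_le_trans ltr01 p1.
move: p1; rewrite le_eqVlt => /predU1P[<-|p1].
  by rewrite subrr !powRr1// powRr0; lra.
have p10 : 0 < p - 1 by rewrite subr_gt0.
have q0 : 0 < p / (p - 1) by rewrite divr_gt0.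
have pq : p^-1 + (p / (p - 1))^-1 = 1 by field; rewrite !gt_eqF.
have := conjugate_powR y0 (powR_ge0 m (p - 1)) p0 q0 pq.
rewrite -powRrM (_ : (p - 1) * (p / (p - 1)) = p); last by field; rewrite gt_eqF.
rewrite -(ler_pM2l p0) (_ : p * (y `^ p / p + m `^ p / (p / (p - 1))) =
  y `^ p + (p - 1) * m `^ p); last by field; rewrite !gt_eqF.
by rewrite -(mulr_powRB1 m0 p0); lra.
Qed.

(** Jensen's inequality, by integrating the tangent line taken at m, the absolute value of the mean
    of phi. *)
Lemma integral_powR_jensen (p x y : R) (phi : R -> R) : 1 <= p -> x < y ->
  mu.-integrable `]x, y] (EFin \o phi) ->
  mu.-integrable `]x, y] (EFin \o (fun t => `|phi t| `^ p)) ->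
  `|\int[mu]_(t in `]x, y]) phi t| `^ p / (y - x) `^ (p - 1) <=
  \int[mu]_(t in `]x, y]) (`|phi t| `^ p).
Proof.
move=> p1 xy iphi iphip; have p0 : 0 < p := lt_le_trans ltr01 p1.
have yx0 : 0 < y - x by rewrite subr_gt0.
have mD : measurable (`]x, y]%classic : set R) by [].
have muD : mu `]x, y]%classic = (y - x)%:E.
  by rewrite lebesgue_measure_itv/= lte_fin xy EFinB.
have Doo : (mu `]x, y]%classic < +oo)%E by rewrite muD ltry.
pose m := `|\int[mu]_(t in `]x, y]) phi t| / (y - x).
have m0 : 0 <= m by rewrite divr_ge0// ltW.
pose c := p * m `^ (p - 1).
have c0 : 0 <= c by rewrite mulr_ge0 ?powR_ge0// ltW.
have inorm : mu.-integrable `]x, y] (EFin \o (fun t => `|phi t|)) by exact: integrable_norm.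
have ic : mu.-integrable `]x, y] (EFin \o (fun t => c * `|phi t|)).
  exact: (@integrableZl _ _ _ mu _ mD c _ inorm).
have ik : mu.-integrable `]x, y] (EFin \o cst (m `^ p - c * m)).
  exact: integrable_cst_lty.
have itan : mu.-integrable `]x, y] (EFin \o (fun t => (m `^ p - c * m) + c * `|phi t|)).
  exact: (integrable_EFinD mD ik ic).
have yxE : fine (mu `]x, y]%classic) = y - x by rewrite muD.
have I1 : \int[mu]_(t in `]x, y]) (m `^ p - c * m + c * `|phi t|) =
    (m `^ p - c * m) * (y - x) + c * \int[mu]_(t in `]x, y]) `|phi t|.
  rewrite (@RintegralD _ _ _ mu _ (cst (m `^ p - c * m)) _ mD ik ic).
  congr (_ + _); last exact: (@RintegralZl _ _ _ mu _ _ c mD inorm).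
  by rewrite -yxE; exact: Rintegral_cst.
have := @le_Rintegral _ _ _ mu _ _ _ mD itan iphip; rewrite I1.
have := @le_normr_Rintegral _ _ _ mu _ _ mD iphi.
have -> : `|\int[mu]_(t in `]x, y]) phi t| = m * (y - x) by rewrite /m divfK// gt_eqF.
move=> mI tan.
have tan' : forall t, `]x, y]%classic t -> m `^ p - c * m + c * `|phi t| <= `|phi t| `^ p.
  move=> t _; apply: le_trans (powR_tangent p1 (normr_ge0 (phi t)) m0).
  by rewrite -/c mulrBr addrAC addrA.
apply: le_trans (tan tan').
rewrite powRM ?(ltW yx0)// -(mulr_powRB1 (ltW yx0) p0).
have -> : m `^ p * ((y - x) * (y - x) `^ (p - 1)) / (y - x) `^ (p - 1) = m `^ p * (y - x).
  by field; rewrite gt_eqF// powR_gt0.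
by rewrite mulrBl -[leLHS]addr0 -addrA lerD2l addrC subr_ge0 -mulrA ler_wpM2l.
Qed.

(** Each a i is at most the p-th root of the sum of the p-th powers. Only finiteness matters, so the
    crude constant n^p is enough. *)
Lemma powR_sum (p : R) n (a : 'I_n -> R) : 0 < p -> (forall i, 0 <= a i) ->
  (\sum_i a i) `^ p <= n%:R `^ p * \sum_i a i `^ p.
Proof.
move=> p0 a0; pose S := \sum_i a i `^ p.
have S0 : 0 <= S by apply: sumr_ge0 => i _; exact: powR_ge0.
have aS i : a i <= S `^ p^-1.
  have -> : a i = (a i `^ p) `^ p^-1 by rewrite -powRrM mulfV ?gt_eqF// powRr1.
  apply: ge0_ler_powR; rewrite ?nnegrE ?powR_ge0 ?invr_ge0 ?(ltW p0)//.
  by rewrite /S (bigD1 i)//= lerDl sumr_ge0// => j _; exact: powR_ge0.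
have H : \sum_i a i <= n%:R * S `^ p^-1.
  apply: (@le_trans _ _ (\sum_(i < n) S `^ p^-1)); first by apply: ler_sum.
  by rewrite sumr_const card_ord mulr_natl.
have H0 : 0 <= \sum_i a i by apply: sumr_ge0.
have H1 : 0 <= n%:R * S `^ p^-1 by rewrite mulr_ge0 ?powR_ge0.
apply: le_trans (ge0_ler_powR (ltW p0) H0 H1 H) _.
by rewrite powRM ?powR_ge0// -powRrM mulVf ?gt_eqF// powRr1.
Qed.
End IntegralVariation.

Section VectorIntegral.
Variables (R : realType) (d : nat) (T p : R).
Hypotheses (T_gt0 : 0 < T) (p_ge1 : 1 <= p).
Notation mu := (@lebesgue_measure R).

Lemma riesz_variation_le_increment (E : Type) (rho : E -> E -> R) (f : R -> E)
    (W : R -> R) :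
  (forall x y, 0 <= x -> x < y -> y <= T ->
     rho (f x) (f y) `^ p / (y - x) `^ (p - 1) <= W y - W x) ->
  (riesz_variation T p rho f <= (W T - W 0)%:E)%E.
Proof.
move=> fW; apply: ge_ereal_sup => _ [s sT <-]; rewrite lee_fin.
apply: (@le_trans _ _ (\sum_(i < size s) (W (nth 0 (0 :: s) i.+1) - W (nth 0 (0 :: s) i)))).
  apply: ler_sum => i _; have [] := itv_partition_bounds sT (ltn_ord i).
  rewrite !in_itv/= => /andP[x0 _] /andP[_ yT] xy; exact: fW.
rewrite -(big_mkord xpredT (fun i => W (nth 0 (0 :: s) i.+1) - W (nth 0 (0 :: s) i))).
by rewrite telescope_sumr//= -(last_nth 0) (eqP (proj2 sT)).
Qed.

Lemma vintegral_BV (x0 : 'rV[R]_d) (psi f : R -> 'rV[R]_d) :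
  (forall i, measurable_fun `[0, T] (fun t => psi t 0 i)) ->
  (forall i, (\int[mu]_(t in `[0%R, T]) (`|psi t 0%R i| `^ p)%:E < +oo)%E) ->
  (forall t, t \in `[0, T] -> f t = x0 + vintegral psi t) ->
  BV T p f.
Proof.
move=> mpsi psip fE; have p0 : 0 < p := lt_le_trans ltr01 p_ge1.
have mT : measurable (`[0, T]%classic : set R) by [].
have ipsi i : mu.-integrable `[0, T] (EFin \o (fun t => psi t 0 i)).
  by apply: (integrable_powR p_ge1 mT) => //; exact: lebesgue_measure_itvcc_lty.
have ipsip i : mu.-integrable `[0, T] (EFin \o (fun t => `|psi t 0 i| `^ p)).
  apply/integrableP; split; first exact: measurable_powR_norm.
  under eq_integral do rewrite /= ger0_norm ?powR_ge0//.
  exact: psip.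
(* By Jensen in each coordinate, the increments of W bound the terms of every Riesz sum, which then
   telescopes; d^p comes from [powR_sum]. *)
pose W (x : R) : R := d%:R `^ p * \sum_i \int[mu]_(t in `[0, x]) (`|psi t 0 i| `^ p).
rewrite /BV/=; apply: (@le_lt_trans _ _ (W T - W 0)%:E); last exact: ltry.
apply: riesz_variation_le_increment => x y x_ge0 xy yT.
have xI : x \in `[0, T] by rewrite in_itv/= x_ge0 (le_trans (ltW xy)).
have yI : y \in `[0, T] by rewrite in_itv/= yT (le_trans x_ge0 (ltW xy)).
have fxy : edistance (f x) (f y) <= \sum_i `|\int[mu]_(t in `]x, y]) psi t 0 i|.
  apply: le_trans (enorm_le_norm1 _) _; apply: ler_sum => i _.
  rewrite !fE// !mxE distrC -(Rintegral_increment (ipsi i) x_ge0 (ltW xy) yT).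
  by rewrite le_eqVlt; apply/orP; left; apply/eqP; congr `|_|; ring.
have yxp : 0 < (y - x) `^ (p - 1) by rewrite powR_gt0// subr_gt0.
rewrite ler_pdivrMr//.
have sum_ge0 : 0 <= \sum_i `|\int[mu]_(t in `]x, y]) psi t 0 i| by apply: sumr_ge0.
apply: le_trans (ge0_ler_powR (ltW p0) (enorm_ge0 _) sum_ge0 fxy) _.
apply: le_trans (powR_sum p0 (fun i => normr_ge0 _)) _.
rewrite /W -mulrBr -mulrA ler_wpM2l ?powR_ge0// -sumrB mulr_suml.
apply: ler_sum => i _; rewrite -ler_pdivrMr//.
rewrite (Rintegral_increment (ipsip i) x_ge0 (ltW xy) yT).
have sub : `]x, y]%classic `<=` `[0, T]%classic.
  move=> t /=; rewrite !in_itv/= => /andP[xt ty].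
  by rewrite (le_trans x_ge0 (ltW xt)) (le_trans ty yT).
have mD : measurable (`]x, y]%classic : set R) by [].
apply: integral_powR_jensen => //.
  exact: (@integrableS _ _ _ mu _ _ _ mT mD sub (ipsi i)).
exact: (@integrableS _ _ _ mu _ _ _ mT mD sub (ipsip i)).
Qed.
End VectorIntegral.

(** * Measurability of set-valued functions *)

Section SetMeasurability.
Variables (R : realType) (d : nat) (T : R).
Implicit Types (u v x y : 'rV[R]_d) (A : set 'rV[R]_d).

Definition ratv (q : 'rV[rat]_d) : 'rV[R]_d := map_mx ratr q.

Lemma ratv_dense x (e : R) : 0 < e ->
  exists q, forall i, `|x 0 i - ratv q 0 i| < e.
Proof.
move=> e0; have xe i : x 0 i - e < x 0 i + e by lra.
have /(_ _)/cid-/all_sig[q qP] i := rat_in_itvoo (xe i).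
exists (\row_i q i) => i; rewrite !mxE ltr_norml.
by have := qP i; rewrite in_itv/= => /andP[]; lra.
Qed.

(** With w = u - v, [norm1 w] is at most d e. The summands in the last factor account for the linear
    term, the support function, and the cross and square terms of dot v v, where e <= 1 gives enorm
    w <= d. *)
Lemma dot_continuity_bound u v x (M e : R) A : bounded_body A ->
  (forall a, A a -> enorm a <= M) -> (forall i, `|u 0 i - v 0 i| <= e) -> e <= 1 ->
  2 * dot u x - 2 * support A u - dot u u <=
  2 * dot v x - 2 * support A v - dot v v +
  d%:R * e * (2 * enorm x + 2 * M + 2 * enorm u + d%:R).
Proof.
move=> bA AM uv e1; set w := u - v.
have v_uw : v = u - w by rewrite /w subKr.
have w1 : norm1 w <= d%:R * e.
  apply: (@le_trans _ _ (\sum_(i < d) e)); first by apply: ler_sum => i _; rewrite !mxE.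
  by rewrite sumr_const card_ord mulr_natl.
have we : enorm w <= d%:R.
  apply: (le_trans (enorm_le_norm1 w)); apply: (le_trans w1).
  by rewrite ler_piMr// ler0n.
have wdot y : `|dot w y| <= d%:R * e * enorm y.
  by apply: le_trans (dot_le_enorm _ _) _; rewrite ler_wpM2r ?enorm_ge0.
have sup_le : support A v <= support A u + d%:R * e * M.
  apply: support_le => [|a Aa]; first by case: bA.
  rewrite v_uw dotC dotBr dotC (dotC a w).
  have := dot_le_support u bA Aa; have := wdot a; rewrite ler_norml => /andP[+ _].
  have : d%:R * e * enorm a <= d%:R * e * M.
    by apply: ler_wpM2l (AM _ Aa); exact: le_trans (norm1_ge0 w) w1.
  by lra.
have H1 := wdot x; have H2 := wdot u; have H3 := wdot w.
have H4 : d%:R * e * enorm w <= d%:R * e * d%:R.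
  by apply: ler_wpM2l we; exact: le_trans (norm1_ge0 w) w1.
have -> : dot v x = dot u x - dot w x by rewrite v_uw dotC dotBr !(dotC x).
have -> : dot v v = dot u u - 2 * dot w u + dot w w.
  rewrite v_uw; have -> : u - w = u - 1 *: w by rewrite scale1r.
  by rewrite dot_subZ (dotC u w); ring.
move: H1 H2 H3; rewrite !ler_norml => /andP[_ H1] /andP[H2 _] /andP[_ H3].
rewrite !mulrDr; lra.
Qed.

(** Leaves countably many conditions, each measurable in t once A depends on t. *)
Lemma meets_ball_rational A x (r : R) : conv_body A ->
  (exists2 b, A b & dot (x - b) (x - b) <= r) <->
  forall q, 2 * dot (ratv q) x - 2 * support A (ratv q) - dot (ratv q) (ratv q) <= r.
Proof.
move=> cA; have bA := conv_body_bounded cA; split=> [/(conv_body_meets_ball _ _ cA) H q//|H].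
apply/(conv_body_meets_ball _ _ cA) => u; apply/ler_addgt0Pr => e e0.
have [_ [M AM]] := bA.
pose K := d%:R * (2 * enorm x + 2 * `|M| + 2 * enorm u + d%:R).
have K0 : 0 <= K.
  by rewrite mulr_ge0// !addr_ge0// ?mulr_ge0// ?enorm_ge0.
have e'0 : 0 < Num.min 1 (e / (K + 1)) by rewrite lt_min ltr01 divr_gt0// ltr_wpDl.
have [q qu] := ratv_dense u e'0.
apply: (le_trans (dot_continuity_bound (v := ratv q) (M := `|M|) x bA _
  (fun i => ltW (qu i)) _)).
- by move=> a /AM /le_trans; apply; exact: ler_norm.
- by rewrite ge_min lexx.
apply: lerD (H q) _; rewrite mulrAC -/K.
apply: (@le_trans _ _ (K * (e / (K + 1)))); first by rewrite ler_wpM2l// ge_min lexx orbT.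
by rewrite mulrA ler_pdivrMr ?ltr_wpDl//; nra.
Qed.

Lemma rational_ball_between (U : set 'rV[R]_d) b : open U -> U b ->
  exists (q : 'rV[rat]_d) (r : rat), dot (ratv q - b) (ratv q - b) <= ratr r /\
    forall y, dot (ratv q - y) (ratv q - y) <= ratr r -> U y.
Proof.
move=> oU Ub; have : nbhs b U by exact: open_nbhs_nbhs.
move=> /nbhs_ballP[e /= e0 eU].
have h0 : 0 < (e / 2) ^+ 2 by rewrite exprn_gt0// divr_gt0.
have [r] := rat_in_itvoo h0; rewrite in_itv/= => /andP[r0 re].
have d0 : 0 < d%:R + 1 :> R by rewrite natr1 ltr0n.
(* As del <= 1, squared coordinates are at most del, so the squared Euclidean distance from the
   centre to b is at most d del <= r. As del <= e / 2 and r < (e / 2)^2, points of the Euclidean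
   ball stay within e of b in the max-norm. *)
pose del : R := Num.min (Num.min 1 (e / 2)) (ratr r / (d%:R + 1)).
have del0 : 0 < del.
  by rewrite !lt_min ltr01 /=; apply/andP; split; rewrite divr_gt0.
have del1 : del <= 1 by rewrite !ge_min lexx.
have dele : del <= e / 2 by rewrite !ge_min lexx orbT.
have delr : del <= ratr r / (d%:R + 1) by rewrite !ge_min lexx orbT.
have [q qb] := ratv_dense b del0; exists q, r; split.
  apply: (@le_trans _ _ (\sum_(i < d) del)).
    apply: ler_sum => i _; rewrite !mxE -expr2 -real_normK ?num_real// distrC.
    have := qb i; rewrite !mxE => /ltW qbi; rewrite expr2.
    exact: le_trans (ler_piMr (normr_ge0 _) (le_trans qbi del1)) qbi.
  rewrite sumr_const card_ord -mulr_natl.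
  move: delr; rewrite ler_pdivlMr//; lra.
move=> y yq; apply: eU; rewrite -ball_normE /ball_/=.
rewrite [ltLHS]/Num.Def.normr/= mx_normrE; apply/bigmax_ltP; split=> // -[i j] _ /=.
rewrite (ord1 i) !mxE.
have qy : `|ratv q 0 j - y 0 j| < e / 2.
  have e20 : 0 <= e / 2 by rewrite divr_ge0// ltW.
  rewrite -(ltr_pXn2r (n := 2)) ?nnegrE//; apply: (le_lt_trans _ re).
  apply: (le_trans _ yq); rewrite real_normK ?num_real// /dot (bigD1 j)//= !mxE -expr2 lerDl.
  by apply: sumr_ge0 => k _; rewrite -expr2 sqr_ge0.
have := qb j; rewrite [ltLHS]/= => qbj.
rewrite -(subrKA (ratv q 0 j)) (le_lt_trans (ler_normD _ _))//; lra.
Qed.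

(** Phi t meets U exactly when it meets one of the countably many rational closed balls inside U,
    and missing such a ball is witnessed by a rational direction. *)
Lemma set_measurable_support (Phi : R -> set 'rV[R]_d) :
  conv_valued T Phi ->
  (forall u, measurable_fun `[0, T] (fun t => support (Phi t) u)) ->
  set_measurable T Phi.
Proof.
move=> cPhi mPhi U oU; set I := [set` _].
have mI : measurable (I : set R) by exact: measurable_itv.
pose E (q : 'rV[rat]_d * rat) : set R := I `&` [set t |
  exists2 b, Phi t b & dot (ratv q.1 - b) (ratv q.1 - b) <= ratr q.2].
have mE q : measurable (E q).
  pose F (v : 'rV[rat]_d) : set R := I `&` [set t | ((ratr q.2)%:E <
    (2 * dot (ratv v) (ratv q.1) - 2 * support (Phi t) (ratv v) -
     dot (ratv v) (ratv v))%:E)%E].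
  have -> : E q = I `\` \bigcup_v F v.
    apply/seteqP; split=> t [It].
      move=> /(meets_ball_rational _ _ (cPhi _ It)) Et; split=> // -[v _ [_]] /=.
      by rewrite lte_fin ltNge Et.
    move=> tF; split=> //=; apply/(meets_ball_rational _ _ (cPhi _ It)) => v.
    by rewrite leNgt; apply/negP => vt; apply: tF; exists v => //; split.
  apply: measurableD => //; apply: countable_bigcupT_measurable => // v.
  apply: measurable_lte => //; apply/measurable_EFinP.
  by apply: measurable_funB => //; apply: measurable_funB => //; exact: measurable_funM.
have -> : I `&` [set t | Phi t `&` U !=set0] =
    \bigcup_(q in [set q | forall y,
      dot (ratv q.1 - y) (ratv q.1 - y) <= ratr q.2 -> U y]) E q.
  apply/seteqP; split=> t.
    move=> [It [b [Pb Ub]]]; have [q [r [qb qU]]] := rational_ball_between oU Ub.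
    by exists (q, r) => //; split=> //; exists b.
  by move=> [q qU [It [b Pb qb]]]; split=> //; exists b; split=> //; exact: qU.
rewrite bigcup_mkcond; apply: countable_bigcupT_measurable => // q.
by case: ifPn.
Qed.
End SetMeasurability.

(** * Scalar L^p functions on [0, T] *)

Section LpFunctions.
Variables (R : realType) (T p : R).
Hypotheses (T_gt0 : 0 < T) (p_ge1 : 1 <= p).
Notation mu := (@lebesgue_measure R).
Let mT : measurable (`[0, T]%classic : set R).
Proof. exact: measurable_itv. Qed.

Let p_gt0 : 0 < p.
Proof. exact: lt_le_trans ltr01 p_ge1. Qed.

Definition Lp_real (f : R -> R) : Prop := measurable_fun `[0, T] f /\
  (\int[mu]_(t in `[0%R, T]) (`|f t| `^ p)%:E < +oo)%E.

Lemma Lp_real_norm f : Lp_real f -> Lp_real (fun t => `|f t|).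
Proof.
move=> [mf fp]; split; first exact: measurableT_comp.
by under eq_integral do rewrite normr_id.
Qed.

Lemma Lp_realD f g : Lp_real f -> Lp_real g -> Lp_real (fun t => f t + g t).
Proof.
move=> [mf fp] [mg gp]; split; first exact: measurable_funD.
apply: le_lt_trans (integral_powR_add p_gt0 mT mf mg) _.
have c0 : (0 <= (2 `^ p : R)%:E)%E by rewrite lee_fin powR_ge0.
have cfin : (2 `^ p : R)%:E \is a fin_num by [].
exact: lte_mul_pinfty c0 cfin (lte_add_pinfty fp gp).
Qed.

Lemma Lp_real_sum (J : Type) (s : seq J) (h : J -> R -> R) :
  (forall j, Lp_real (h j)) -> Lp_real (fun t => \sum_(j <- s) h j t).
Proof.
move=> hp; elim: s => [|j s IHs].
  under [X in Lp_real X]eq_fun do rewrite big_nil.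
  split; first exact: measurable_cst.
  under eq_integral do rewrite normr0 powR0 ?gt_eqF//.
  by rewrite integral0.
have -> : (fun t => \sum_(i <- j :: s) h i t) = (fun t => h j t + \sum_(i <- s) h i t).
  by apply/funext => t; rewrite big_cons.
exact: (Lp_realD (hp j) IHs).
Qed.

Lemma Lp_real_integrable f : Lp_real f -> mu.-integrable `[0, T] (EFin \o f).
Proof.
move=> [mf fp]; apply: (integrable_powR p_ge1 mT) fp => //.
exact: lebesgue_measure_itvcc_lty.
Qed.

Lemma Rintegral_sum (J : Type) (s : seq J) (h : J -> R -> R) (D : set R) :
  measurable D -> (forall j, mu.-integrable D (EFin \o h j)) ->
  mu.-integrable D (EFin \o (fun t => \sum_(j <- s) h j t)) /\
  \int[mu]_(t in D) (\sum_(j <- s) h j t) = \sum_(j <- s) \int[mu]_(t in D) h j t.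
Proof.
move=> mD ih; elim: s => [|j s [IH1 IH2]].
  rewrite big_nil; split.
    have -> : (fun t => \sum_(j <- [::]) h j t) = cst 0 by apply/funext => t; rewrite big_nil.
    exact: integrable0.
  by under eq_Rintegral do rewrite big_nil; rewrite /Rintegral integral0.
have -> : (fun t => \sum_(i <- j :: s) h i t) = (fun t => h j t + \sum_(i <- s) h i t).
  by apply/funext => t; rewrite big_cons.
split; first exact: (integrable_EFinD mD (ih j) IH1).
by rewrite (@RintegralD _ _ _ mu _ _ _ mD (ih j) IH1) IH2 big_cons.
Qed.

Lemma measurable_enorm_powR d (psi : R -> 'rV[R]_d) :
  (forall i, measurable_fun `[0, T] (fun t => psi t 0 i)) ->
  measurable_fun `[0, T] (fun t => (enorm (psi t) `^ p)%:E).
Proof.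
move=> mpsi; apply/measurable_EFinP; apply: (measurableT_comp (measurable_powR p)).
have -> : (fun t => enorm (psi t)) = (fun t => (\sum_i (psi t 0 i) ^+ 2) `^ 2^-1).
  by apply/funext => t; rewrite powR12_sqrt//; apply: sumr_ge0 => i _; exact: sqr_ge0.
apply: (measurableT_comp (measurable_powR _)).
by apply: measurable_sum => i; exact: measurable_funX.
Qed.

Lemma Lp_real_coord d (psi : R -> 'rV[R]_d) i :
  (forall i, measurable_fun `[0, T] (fun t => psi t 0 i)) ->
  (\int[mu]_(t in `[0%R, T]) (enorm (psi t) `^ p)%:E < +oo)%E ->
  Lp_real (fun t => psi t 0 i).
Proof.
move=> mpsi psip; split; first exact: mpsi.
apply: le_lt_trans psip; apply: ge0_le_integral; first exact: mT.
- by move=> t _; rewrite lee_fin powR_ge0.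
- exact: (measurable_powR_norm p (mpsi i)).
- exact: measurable_enorm_powR.
- move=> t _; rewrite lee_fin ge0_ler_powR ?nnegrE ?enorm_ge0//.
    exact: ltW.
  exact: coord_le_enorm.
Qed.
End LpFunctions.

(** * Coordinates and derivatives of vector integrals *)

Section VectorIntegralFacts.
Variables (R : realType) (d : nat) (T : R).
Hypotheses (T_gt0 : 0 < T).
Notation mu := (@lebesgue_measure R).
Implicit Types (phi psi f : R -> 'rV[R]_d).

(** Replaces a member of [Lp_fun], possibly not Borel, by its Borel representative; hence the
    comparison of integrals without measurability. *)
Lemma vintegral_ae_eq phi psi t : t \in `[0, T] ->
  {ae mu, forall s, s \in `[0, T] -> phi s = psi s} ->
  vintegral phi t = vintegral psi t.
Proof.
rewrite in_itv/= => /andP[_ tT] phipsi; apply/rowP => i; rewrite !mxE /Rintegral.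
congr fine; apply: nonmeasurable_ae_eq_integral; move: phipsi.
apply: filterS; first exact: (ae_filter_ringOfSetsType mu).
move=> s ps /=; rewrite in_itv/= => /andP[s0 st]; rewrite ps// in_itv/= s0.
exact: le_trans st tT.
Qed.

Lemma vintegral0 phi : vintegral phi 0 = 0.
Proof. by apply/rowP => i; rewrite !mxE set_itv1 Rintegral_set1. Qed.

Lemma dot_vintegral (u : 'rV[R]_d) psi t : t <= T ->
  (forall i, mu.-integrable `[0, T] (EFin \o (fun s => psi s 0 i))) ->
  mu.-integrable `[0, t] (EFin \o (fun s => dot u (psi s))) /\
  dot u (vintegral psi t) = \int[mu]_(s in `[0, t]) dot u (psi s).
Proof.
move=> tT ipsi; have mt : measurable (`[0, t]%classic : set R) by exact: measurable_itv.
have it i : mu.-integrable `[0, t] (EFin \o (fun s => psi s 0 i)).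
  exact: (@integrable_sub_itv R T (fun s => psi s 0 i) (ipsi i) t tT).
have iu i : mu.-integrable `[0, t] (EFin \o (fun s => u 0 i * psi s 0 i)).
  exact: (@integrableZl _ _ _ mu _ mt (u 0 i) _ (it i)).
have [iS ES] := Rintegral_sum (index_enum 'I_d) mt iu.
split=> //; rewrite /dot ES; apply: eq_bigr => i _.
by rewrite mxE (@RintegralZl _ _ _ mu _ _ (u 0 i) mt (it i)).
Qed.

Lemma ae_derivable_vintegral (x0 : 'rV[R]_d) psi f :
  (forall i, mu.-integrable `[0, T] (EFin \o (fun s => psi s 0 i))) ->
  (forall t, t \in `[0, T] -> f t = x0 + vintegral psi t) ->
  {ae mu, forall t, t \in `[0, T] -> derivable f t 1 /\ derive1 f t = psi t}.
Proof.
move=> ipsi fE.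
have aeF : {ae mu, forall t, forall i, t \in `]0, T[ ->
    derivable (fun x : R => \int[mu]_(s in `[0, x]) psi s 0 i) t 1 /\
    derive1 (fun x : R => \int[mu]_(s in `[0, x]) psi s 0 i) t = psi t 0 i}.
  apply: (@filter_forall _ _ _ _ (ae_filter_ringOfSetsType mu)) => i.
  exact: ae_derivable_integral (ipsi i).
have ne (x : R) : {ae mu, forall t, t != x}.
  exists [set x]; split => //; first exact: lebesgue_measure_set1.
  by move=> t /= /negP; rewrite negbK => /eqP.
(* f is arbitrary off [0, T], so a two-sided derivative can be computed only at interior points. *)
apply: (@filterS3 _ _ (ae_filter_ringOfSetsType mu) _ _ _ _ _ aeF (ne 0) (ne T)).
move=> t Ft t_0 t_T; rewrite in_itv/= => /andP[t0 tT].
have tI : t \in `]0, T[ by rewrite in_itv/= !lt_neqAle eq_sym t_0 t0 t_T.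
have near_fE i : {near t, (fun s => x0 0 i + \int[mu]_(r in `[0, s]) psi r 0 i) =1
    (fun s => f s 0 i)}.
  near=> s; rewrite fE ?mxE//.
  by apply: subset_itv_oo_cc; near: s; exact: near_in_itvoo.
have dI i := (Ft i tI).1.
have df : derivable f t 1.
  apply/derivable_mxP => i j; rewrite (ord1 i).
  apply: near_eq_derivable (near_fE j) _; apply: derivableD; last exact: dI.
  exact: derivable_cst.
split=> //; rewrite derive1E derive_mx//; apply/rowP => j; rewrite mxE.
rewrite -(near_eq_derive _ (near_fE j)) deriveD; [|exact: derivable_cst|exact: dI].
by rewrite derive_cst add0r -derive1E (Ft j tI).2.
Unshelve. all: by end_near. Qed.
End VectorIntegralFacts.

(** * Selections of the Hukuhara derivative *)

Section HukuharaIntegral.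
Variables (R : realType) (d : nat) (T p : R) (x0 : 'rV[R]_d) (F : R -> set 'rV[R]_d).
Hypotheses (T_gt0 : 0 < T) (p_ge1 : 1 <= p).
Hypotheses (hF : hukuhara_differentiable T F) (hBV : BV_conv T p F).
Hypothesis hF0 : F 0 = [set x0].
Notation mu := (@lebesgue_measure R).

Let cF : conv_valued T F.
Proof. by case: hBV. Qed.

Let p_gt0 : 0 < p.
Proof. exact: lt_le_trans ltr01 p_ge1. Qed.

Lemma support_D_H_Lp u : Lp_real T p (fun t => support (D_H T F t) u).
Proof.
pose g t := support (D_H T F t) u.
have sF t : t \in `[0, T] -> derives_within T (fun s => support (F s) u) t (g t).
  exact: support_derives_within.
split; first exact: (measurable_derives_within T_gt0 sF).
apply: le_lt_trans (integral_derives_within_powR T_gt0 p_gt0 sF) _.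
have [_] := hBV; apply: (riesz_variation_transfer p_ge1 (norm1_ge0 u)) => x y xT yT.
have bx := conv_body_bounded (cF xT); have by_ := conv_body_bounded (cF yT).
by split; [exact: hausdorff_ge0|exact: normr_ge0|exact: support_dist_hausdorff].
Qed.

Lemma D_H_set_measurable : set_measurable T (D_H T F).
Proof.
apply: set_measurable_support => [t tT|u]; first exact: D_H_conv_body hF tT.
by case: (support_D_H_Lp u).
Qed.

Lemma D_H_p_integrably_bounded : p_integrably_bounded T p (D_H T F).
Proof.
(* The support function in the directions of the basis vectors and of their opposites bounds every
   coordinate of a point of [D_H]. *)
pose g t := \sum_(i < d) (`|support (D_H T F t) (delta_mx 0 i)| +
  `|support (D_H T F t) (- delta_mx 0 i)|).
have [mg gp] : Lp_real T p g.
  apply: Lp_real_sum => // i.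
  by apply: Lp_realD => //; apply: Lp_real_norm; exact: support_D_H_Lp.
exists g; split => //; apply: aeW => t tT.
have cD := D_H_conv_body hF tT; have [D0 _ _] := cD; have bD := conv_body_bounded cD.
apply: ge_sup; first by have [a Da] := D0; exists (enorm a), a.
move=> _ [a Da <-]; apply: le_trans (enorm_le_norm1 a) _; apply: ler_sum => i _.
rewrite ler_norml; apply/andP; split.
  rewrite lerNl -[a 0 i]dot_delta -dotNl (le_trans (dot_le_support _ bD Da))//.
  by rewrite (le_trans (ler_norm _))// lerDr.
rewrite -[a 0 i]dot_delta (le_trans (dot_le_support _ bD Da))//.
by rewrite (le_trans (ler_norm _))// lerDl.
Qed.

Lemma vintegral_IS phi f : S_L T p (D_H T F) phi ->
  (forall t, t \in `[0, T] -> f t = x0 + vintegral phi t) -> IS T p F f.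
Proof.
move=> [[psi [phipsi mpsi psip]] phiD] fE0.
have fE t : t \in `[0, T] -> f t = x0 + vintegral psi t.
  by move=> tT; rewrite fE0// (vintegral_ae_eq tT phipsi).
have Lpsi i : Lp_real T p (fun t => psi t 0 i) by exact: Lp_real_coord.
have ipsi i : mu.-integrable `[0, T] (EFin \o (fun t => psi t 0 i)).
  exact: Lp_real_integrable (Lpsi i).
have psiD : {ae mu, forall t, t \in `[0, T] -> D_H T F t (psi t)}.
  apply: filterS2 phipsi phiD; first exact: (ae_filter_ringOfSetsType mu).
  by move=> t pp Dp tT; rewrite -pp//; exact: Dp.
have fBV : BV T p f.
  by apply: (vintegral_BV p_ge1 mpsi _ fE) => i; case: (Lpsi i).
have df := ae_derivable_vintegral ipsi fE.
split=> //.
- split=> // t tT; apply: conv_body_mem; first exact: cF.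
  move=> u; have := tT; rewrite in_itv/= => /andP[].
  rewrite le_eqVlt => /predU1P[<- _|t0 tT'].
    rewrite fE; last by rewrite in_itv/= lexx ltW.
    by rewrite vintegral0 addr0 hF0 support_set1.
  have [iu uE] := dot_vintegral u tT' ipsi.
  (* Since F 0 = {x0}, dot u x0 is the value at 0 of the support function, and the goal bounds an
     integral by its increment over [0, t]. *)
  rewrite fE// dotDr uE -lerBrDl -(support_set1 x0 u) -hF0.
  have inI s : s \in `[0, t] -> s \in `[0, T].
    by rewrite !in_itv/= => /andP[-> st]; exact: le_trans st tT'.
  apply: (integral_le_derivative t0 (q := fun s => support (F s) u)
    (g := fun s => support (D_H T F s) u)) => //.
    move=> s /inI sT; apply: derives_within_restrict tT' _.
    exact: support_derives_within.
  move: psiD; apply: filterS; first exact: (ae_filter_ringOfSetsType mu).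
  move=> s sD /inI sT; apply: dot_le_support; last exact: sD.
  exact/conv_body_bounded/D_H_conv_body.
- move: df; apply: filterS; first exact: (ae_filter_ringOfSetsType mu).
  by move=> t dft /dft[].
- split.
    exists psi; split=> //; move: df; apply: filterS.
      exact: (ae_filter_ringOfSetsType mu).
    by move=> t dft /dft[].
  apply: filterS2 df psiD; first exact: (ae_filter_ringOfSetsType mu).
  by move=> t dft Dp tT; have [_ ->] := dft tT; exact: Dp.
Qed.

Lemma IS0 f : IS T p F f -> f 0 = x0.
Proof.
move=> [_ [_ fF] _ _]; have : F 0 (f 0) by apply: fF; rewrite in_itv/= lexx ltW.
by rewrite hF0.
Qed.

Lemma IS_vintegral f t : 1 < p -> IS T p F f -> t \in `[0, T] ->
  f t = x0 + vintegral (derive1 f) t.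
Proof.
move=> p1 fIS tT; rewrite -(IS0 fIS); have [fBV _ df [[psi [fpsi mpsi psip]] _]] := fIS.
have := tT; rewrite in_itv/= => /andP[].
rewrite le_eqVlt => /predU1P[<- _|t0 tT']; first by rewrite vintegral0 addr0.
rewrite (vintegral_ae_eq tT fpsi); apply/rowP => i.
have Lpsi : Lp_real T p (fun t => psi t 0 i) by exact: Lp_real_coord.
have sub : `[0, t]%classic `<=` `[0, T]%classic.
  by move=> s /=; rewrite !in_itv/= => /andP[-> st]; exact: le_trans st tT'.
have mT : measurable (`[0, T]%classic : set R) by exact: measurable_itv.
have mt : measurable (`[0, t]%classic : set R) by exact: measurable_itv.
(* The theorem on [0, T] is applied with t in place of T, coordinate by coordinate. *)
rewrite !mxE -(@riesz_FTC R t t0 (fun s => f s 0 i) (fun s => psi s 0 i) p p1).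
- by rewrite subrKC.
- apply: le_lt_trans (riesz_variation_restrict _ _ _ tT') _.
  move: fBV; apply: (riesz_variation_transfer p_ge1 ler01) => x y _ _.
  split; [exact: enorm_ge0|exact: normr_ge0|rewrite mul1r].
  by have := coord_le_enorm (f x - f y) i; rewrite !mxE.
- exact: measurable_funS mT sub (mpsi i).
- case: Lpsi => _; apply: le_lt_trans; apply: ge0_subset_integral => //.
  exact: (measurable_powR_norm p (mpsi i)).
- apply: filterS2 df fpsi; first exact: (ae_filter_ringOfSetsType mu).
  move=> s ds fs /sub sT; have dfs := ds sT.
  rewrite -fs// derive1E derive_mx// mxE -derive1E.
  by apply: derivable_derives_within; move/derivable_mxP: dfs; exact.
Qed.

Lemma IS_decomposable : decomposable T p (IS T p F).
Proof.
split=> [f []//|f1 f2 a IS1 IS2 aT].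
pose w1 (t : R) : R := \1_(`[0, a[) t; pose w2 (t : R) : R := \1_(`[a, T]) t.
(* On [0, T] exactly one weight is 1, so [comb] switches from h1 to h2 at a and pointwise membership
   in [D_H] is inherited from whichever function is active. *)
pose comb (h1 h2 : R -> 'rV[R]_d) t := w1 t *: h1 t + w2 t *: h2 t.
have combE h1 h2 t : t \in `[0, T] -> comb h1 h2 t = if t < a then h1 t else h2 t.
  rewrite in_itv/= /comb /w1 /w2 !indicE => /andP[t0 tT].
  have -> : (t \in `[0, a[%classic) = (t < a).
    by apply/idP/idP; rewrite inE/= in_itv/= t0.
  have -> : (t \in `[a, T]%classic) = (a <= t).
    by apply/idP/idP; rewrite inE/= in_itv/= tT andbT.
  by case: ltP; rewrite ?scale1r ?scale0r ?addr0 ?add0r.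
have [_ _ _ [[psi1 [f1psi m1 p1]] D1]] := IS1.
have [_ _ _ [[psi2 [f2psi m2 p2]] D2]] := IS2.
apply: (@vintegral_IS (comb (derive1 f1) (derive1 f2))) => [|t tT]; last first.
  by rewrite /oplus (IS0 IS1).
split.
  exists (comb psi1 psi2); split.
  - apply: filterS2 f1psi f2psi; first exact: (ae_filter_ringOfSetsType mu).
    by move=> t e1 e2 tT; rewrite !combE// e1// e2.
  - move=> i.
    have -> : (fun t => comb psi1 psi2 t 0 i) =
        (fun t => w1 t * psi1 t 0 i + w2 t * psi2 t 0 i).
      by apply/funext => t; rewrite /comb !mxE.
    by apply: measurable_funD; apply: measurable_funM => //; exact: measurable_indic.
  - apply: le_lt_trans (lte_add_pinfty p1 p2).
    have mT : measurable (`[0, T]%classic : set R) by exact: measurable_itv.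
    rewrite -ge0_integralD//.
    + apply: nonmeasurable_ae_ge0_le_integral => [t _|t _|].
      * by rewrite lee_fin powR_ge0.
      * by rewrite adde_ge0// lee_fin powR_ge0.
      * apply: aeW => t tT; rewrite -EFinD lee_fin combE//.
        by case: ifP => _; rewrite ?lerDl ?lerDr powR_ge0.
    + by move=> t _; rewrite lee_fin powR_ge0.
    + exact: measurable_enorm_powR m1.
    + by move=> t _; rewrite lee_fin powR_ge0.
    + exact: measurable_enorm_powR m2.
apply: filterS2 D1 D2; first exact: (ae_filter_ringOfSetsType mu).
by move=> t d1 d2 tT; rewrite combE//; case: ifP => _; [exact: d1|exact: d2].
Qed.

Lemma IS_is_integral : 1 < p -> is_integral T p (IS T p F).
Proof.
move=> p1; split=> [f []//|]; exists x0, (D_H T F); split.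
- by move=> t tT; exact: D_H_conv_body hF tT.
- exact: D_H_set_measurable.
- exact: D_H_p_integrably_bounded.
- apply/seteqP; split=> [f fIS|f [_ [phi Sphi fE]]]; last exact: vintegral_IS Sphi fE.
  have [fBV _ _ Sf] := fIS; split=> //; exists (derive1 f) => // t tT.
  exact: IS_vintegral.
Qed.
End HukuharaIntegral.

Theorem theorem4 (R : realType) (d : nat) (T p : R) (x0 : 'rV[R]_d)
    (F : R -> set 'rV[R]_d)
    (hd : (0 < d)%N) (hT : 0 < T) (hp : 1 <= p)
    (hF : hukuhara_differentiable T F)
    (hBV : BV_conv T p F)
    (hF0 : F 0 = [set x0]) :
  decomposable T p (IS T p F) /\ (1 < p -> is_integral T p (IS T p F)).
Proof.
split; first exact: (IS_decomposable hT hp hF hBV hF0).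
exact: (IS_is_integral hT hp hF hBV hF0).
Qed.
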